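(* Let $T$ be a maximal elliptic torus of $Sp(W)$, with $W=W_1\oplus\cdots\oplus W_n$, $T=T_1\times\cdots\times T_n$, lattices $B_i\subset A_i\subset B_i^*$ in $W_i$, $B=\bigoplus B_i$, $A=\bigoplus A_i$, and lifts of $T$, $T_i$ to $Mp(W)$, $Mp(W_i)$ by $s_B$, $s_{B_i}$, as in the context. (i) A character $\chi$ of $T$ occurs in the restriction to $T$ of the Weil representation $S_{W,\psi}$ if and only if, for each $1\le i\le n$, the character $\chi_{|T_i}$ of $T_i$ occurs in the restriction to $T_i$ of the Weil representation $S_{W_i,\psi}$. (ii) Let $\chi$ be a character of $T$ satisfying the equivalent conditions of (i). For $1\le i\le n$ let $\chi_i=\chi_{|T_i}$ and choose an eigenfunction $\varphi_{\chi_i}\in\mathcal{H}^{A_i}_\psi$ of weight $\chi_i$ for the restriction of $S_{W_i,\psi}$ to $T_i$. Then $$\varphi_\chi:=\varphi_{\chi_1}\otimes\cdots\otimes\varphi_{\chi_n}$$ is an eigenfunction of weight $\chi$ in $\mathcal{H}^A_\psi$ for the restriction of $S_{W,\psi}$ to $T$.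
   Context: $k$ is a non-archimedean local field of characteristic $0$ with ring of integers $\mathcal{O}$, uniformizer $\varpi$, residue field $\mathbb{F}_q$ of characteristic $p\neq2$; $\psi$ is a non-trivial unitary character of $(k,+)$ with conductor $\lambda_\psi$ (trivial on $\varpi^{\lambda_\psi}\mathcal{O}$, not on $\varpi^{\lambda_\psi-1}\mathcal{O}$); $\overline\psi$ is the character of $\mathbb{F}_q$ with $\overline\psi(x\bmod\varpi)=\psi(\varpi^{\lambda_\psi-1}x)$. $(W,\beta)$ is a non-zero finite-dimensional symplectic $k$-space. A torus of $Sp(W)$ is elliptic if it is anisotropic (equivalently compact). For a maximal elliptic torus $T$, $W$ decomposes uniquely as an orthogonal direct sum of symplectic $T$-submodules $W_i$ irreducible over $k$; the image $T_i$ of $T$ under $x\mapsto x_{|W_i}$ is a maximal torus of $Sp(W_i)$ acting irreducibly, and $T\cong\prod T_i$ via $x\mapsto(x_{|W_i})_i$. **Lattices.** A lattice is a compact open $\mathcal{O}$-submodule; $L^*=\{v:\beta(v,b)\in\varpi^{\lambda_\psi}\mathcal{O}\ \forall b\in L\}$; $L$ is good if $\varpi L^*\subset L\subset L^*$, self-dual if $L=L^*$. $K_L$ is the stabilizer of $L$ in the symplectic group. **Choice of $B_i,A_i$.** Each $(W_i,T_i)$ is (isomorphic to, and identified with) the following: an extension $k'/k$ of degree $\frac12\dim W_i$, a quadratic extension $k''/k'$ with Galois involution $\tau$, rings of integers $\mathcal{O}',\mathcal{O}''$, uniformizers $\varpi',\varpi''$ with $\varpi''^2=\varpi'$ if $k''/k'$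 is ramified and $\varpi''=\varpi'$ otherwise, an element $u\in k''^\times$ of trace $0$ over $k'$ with $u=\varpi''$ if ramified and $v''(u)\in\{0,1\}$ otherwise ($v''$ the normalized valuation); $W_i=k''$ with form $\frac12\mathrm{tr}_{k''/k}(ux^\tau y)$, $T_i=\{t\in k''^\times: tt^\tau=1\}$. With $e$ the ramification index and $\varpi'^\delta\mathcal{O}'$ the different of $k'/k$, $\mu=e\lambda_\psi-\delta-v''(u)$, one puts $B_i=\varpi''^\mu\mathcal{O}''$ if ramified, $B_i=\varpi'^{[(\mu+1)/2]}\mathcal{O}''$ if unramified; $B_i$ is a $T_i$-invariant good lattice. If $B_i$ is self-dual, $A_i=B_i$; otherwise ($k''/k'$ unramified, $\mu$ odd) $A_i=\varpi'^{\frac{\mu-1}2}(\mathcal{O}'+\mathcal{O}'\varpi'\nu)$ where $u=\varpi'^{v''(u)}\nu$; $A_i$ is self-dual with $B_i\subset A_i\subset B_i^*$. Then $B$ is a $T$-invariant good lattice and $A$ a self-dual lattice of $W$ with $B\subset A\subset B^*$. **Weil representations and sections.** $H(W)=W\times k$ with $(w,t)(w',t')=(w+w',t+t'+\frac12\beta(w,w'))$. $\mathcal{H}^A_\psi$ is the Hilbert space of functions $\varphi:W\to\mathbb{C}$ with $\varphi(a+w)=\psi(\frac12\beta(w,a))\varphi(w)$ ($a\in A$), $\int_{W/A}|\varphi|^2<\infty$, with $\rho_\psi^A(w,t)\varphi(w')=\psi(t+\frac12\beta(w',w))\varphi(w'+w)$. $Mp(W)$ is the unique subgroup of $\{(g,U)\in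 Sp(W)\times U(\mathcal{H}^A_\psi):U\rho^A_\psi(w,t)U^{-1}=\rho^A_\psi(gw,t)\}$ projecting onto $Sp(W)$ with kernel of order $2$; the Weil representation $S_{W,\psi}$ is $(g,U)\mapsto U$. $\mathrm{b}^*=B^*/B$ has the $\mathbb{F}_q$-symplectic form $\varpi^{1-\lambda_\psi}\beta\bmod\varpi$ and dimension $2l$; $\mathrm{x}=A/B$ is a Lagrangian; for $g\in K_B$ let $\bar g$ be its image in $Sp(\mathrm{b}^* )$. Put $j(h)=l-\dim(\mathrm{x}\cap h\mathrm{x})$ for $h\in Sp(\mathrm b^* )$, $\omega(a)=q^{-1/2}\sum_{t\in\mathbb{F}_q}\overline\psi(\frac12at^2)$, and let $\theta:Sp(\mathrm{b}^* )\to\mathbb{F}_q^\times/(\mathbb{F}_q^\times)^2$ be the function with $\theta(p_1hp_2)=\theta(p_1)\theta(h)\theta(p_2)$ for $p_1,p_2$ in the stabilizer $P$ of $\mathrm{x}$, $\theta(p)=\det(p_{|\mathrm{x}})$ for $p\in P$, $\theta(\tau_S)=1$ for $S\subset\{1,\dots,l\}$, where, for a symplectic basis $(\epsilon_i,\phi_i)$ with the $\epsilon_i$ spanning $\mathrm{x}$, $\tau_S\epsilon_i=\phi_i$, $\tau_S\phi_i=-\epsilon_i$ for $i\in S$ and $\tau_S$ fixes the other basis vectors. Put $m(h)=\omega(\theta(h))^{-1}\omega(1)^{1-j(h)}$. The section $s_B:K_B\to Mp(W)$ is the homomorphism $g\mapsto(g,S^A_\psi(g))$, $$S^A_\psi(g)\varphi(w)=m(\bar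 g)q^{j(\bar g)/2}[A:A\cap gA]^{-1}\sum_{a\in A/(A\cap gA)}\psi(\tfrac12\beta(a,w))\varphi(g^{-1}(a+w)).$$ The same definitions with $(W_i,B_i,A_i)$ give $\mathcal{H}^{A_i}_\psi$, $Mp(W_i)$, $S_{W_i,\psi}$, $s_{B_i}$. For $\varphi_i\in\mathcal{H}^{A_i}_\psi$, $\varphi_1\otimes\cdots\otimes\varphi_n\in\mathcal{H}^A_\psi$ is $(\varphi_1\otimes\cdots\otimes\varphi_n)(w_1+\cdots+w_n)=\varphi_1(w_1)\cdots\varphi_n(w_n)$, $w_i\in W_i$. *)

(* Defs.v *)
From HB Require Import structures.
From mathcomp Require Import all_boot all_order all_algebra all_field.
From mathcomp Require Import finmap.
From mathcomp Require Import boolp classical_sets functions cardinality fsbigop.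
From mathcomp Require Import reals constructive_ereal ereal esum.
From mathcomp Require Import complex.

Set Implicit Arguments.
Unset Strict Implicit.
Unset Printing Implicit Defensive.

Import Order.TTheory GRing.Theory Num.Theory.
Local Open Scope classical_set_scope.
Local Open Scope ring_scope.

(** ** Valuations and local fields *)

(* Normalized discrete valuation; the value [v 0] is irrelevant. *)
Definition normalized_valuation (F : fieldType) (v : F -> int) : Prop :=
  [/\ forall x y, x != 0 -> y != 0 -> v (x * y) = v x + v y,
      forall x y, x != 0 -> y != 0 -> x + y != 0 ->
        Num.min (v x) (v y) <= v (x + y)
    & exists2 x, x != 0 & v x = 1].

(* The fractional ideal of elements of valuation at least [m]; the ring of
   integers is [videal v 0]. *)
Definition videal (F : fieldType) (v : F -> int) (m : int) : set F :=
  [set x | x = 0 \/ m <= v x].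

Definition vcomplete (F : fieldType) (v : F -> int) : Prop :=
  forall x : nat -> F,
    (forall m : int, exists N : nat, forall i j : nat,
       (N <= i)%N -> (N <= j)%N -> videal v m (x i - x j)) ->
    exists l : F, forall m : int, exists N : nat, forall i : nat,
      (N <= i)%N -> videal v m (x i - l).

(* A non-archimedean local field of characteristic 0 and odd residual
   characteristic, with a fixed uniformizer and an identification of the residue
   field with [Fq]. The reduction [lf_red] is meaningful on the integers only. *)
Record localField (k : fieldType) (Fq : finFieldType) := LocalField {
  lf_val : k -> int;
  lf_unif : k;
  lf_red : k -> Fq;
  lf_char0 : [pchar k] =i pred0;
  lf_odd : (2 \notin [pchar Fq])%N;
  lf_valP : normalized_valuation lf_val;
  lf_complete : vcomplete lf_val;
  lf_unifP : lf_unif != 0 /\ lf_val lf_unif = 1;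
  lf_redD : {in videal lf_val 0 &, {morph lf_red : x y / x + y}};
  lf_redM : {in videal lf_val 0 &, {morph lf_red : x y / x * y}};
  lf_red1 : lf_red 1 = 1;
  lf_red_surj : forall y, exists2 x, videal lf_val 0 x & lf_red x = y;
  lf_red_ker : forall x, videal lf_val 0 x ->
    (lf_red x = 0 <-> videal lf_val 1 x) }.

Definition lf_int (k : fieldType) (Fq : finFieldType) (K : localField k Fq) :
  set k := videal (lf_val K) 0.

(* Continuity and non-triviality follow from the existence of a conductor. *)
Definition unitary_character (R : realType) (k : fieldType) (Fq : finFieldType)
    (K : localField k Fq) (psi : k -> R[i]) (lam : int) : Prop :=
  [/\ forall x y, psi (x + y) = psi x * psi y,
      forall x, `|psi x| = 1,
      forall x, videal (lf_val K) lam x -> psi x = 1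
    & exists2 x, videal (lf_val K) (lam - 1) x & psi x != 1].

(** ** Symplectic spaces and tori *)

Section Symplectic.
Variables (k : fieldType) (W : vectType k).
Implicit Types (beta : W -> W -> k) (T Z : set 'End(W)).

Definition symplectic_form beta : Prop :=
  [/\ forall a x y z, beta (a *: x + y) z = a * beta x z + beta y z,
      forall a x y z, beta z (a *: x + y) = a * beta z x + beta z y,
      forall x, beta x x = 0
    & forall x, (forall y, beta x y = 0) -> x = 0].

Definition Sp beta : set 'End(W) :=
  [set g | forall x y, beta (g x) (g y) = beta x y].

(* Polynomial functions on End(W): the algebra generated by the linear forms. *)
Inductive polyfun : ('End(W) -> k) -> Prop :=
| polyfun_lin (l : {linear 'End(W) -> k^o}) : polyfun (fun g => l g)
| polyfun_cst (c : k) : polyfun (fun=> c)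
| polyfun_add f1 f2 : polyfun f1 -> polyfun f2 -> polyfun (fun g => f1 g + f2 g)
| polyfun_mul f1 f2 : polyfun f1 -> polyfun f2 ->
    polyfun (fun g => f1 g * f2 g).

Definition zariski_closed Z : Prop :=
  exists2 S : set ('End(W) -> k), S `<=` [set f | polyfun f]
    & Z = [set g | forall f, S f -> f g = 0].

Definition zariski_connected T : Prop :=
  forall Z1 Z2, zariski_closed Z1 -> zariski_closed Z2 ->
    T `<=` Z1 `|` Z2 -> T `&` Z1 `&` Z2 = set0 -> T `<=` Z1 \/ T `<=` Z2.

Definition subgroup T : Prop :=
  [/\ T \1%VF, forall g h, T g -> T h -> T (g \o h)%VF
    & forall g, T g -> T (g^-1)%VF].

Definition codiag_over (F : fieldType) (f : {rmorphism k -> F}) T : Prop :=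
  exists2 P : 'M[F]_(\dim {:W}), P \in unitmx
    & forall g, T g ->
        is_diag_mx (P *m map_mx f (passmx.mxof (vbasis {:W}) (vbasis {:W}) g)
                      *m invmx P).

(* A torus of Sp(W) is represented by its group of k-rational points, which is
   Zariski dense in it since k is perfect and infinite: a Zariski-closed
   connected subgroup, diagonalizable over a finite extension. *)
Definition torus beta T : Prop :=
  [/\ T `<=` Sp beta, subgroup T, zariski_closed T, zariski_connected T
    & exists L : fieldExtType k, codiag_over (in_alg L) T].

Definition split_torus beta T : Prop :=
  torus beta T /\ codiag_over idfun T.

(* Elliptic means anisotropic: there is no non-trivial split subtorus. *)
Definition elliptic beta T : Prop :=
  forall S, split_torus beta S -> S `<=` T -> S = [set \1%VF].

Definition maximal_torus beta T : Prop :=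
  torus beta T /\ forall T', torus beta T' -> T `<=` T' -> T' = T.

Definition maximal_elliptic_torus beta T : Prop :=
  maximal_torus beta T /\ elliptic beta T.

(* Continuous homomorphisms from [T] to the non-zero complex numbers, for the
   topology of End(W) given by the valuation of the coordinates. *)
Definition character (R : realType) (v : k -> int) T (chi : 'End(W) -> R[i]) :
  Prop :=
  [/\ chi \1%VF = 1,
      forall g h, T g -> T h -> chi (g \o h)%VF = chi g * chi h
    & forall g, T g -> forall eps : R[i], 0 < eps -> exists m : int,
        forall h, T h ->
          (forall i, videal v m (coord (vbasis {:'End(W)}) i (h - g))) ->
          `|chi h - chi g| < eps].

End Symplectic.

(** ** Lattices and the Weil representation on functions on W *)

Section Weil.
Variables (R : realType) (k : fieldType) (Fq : finFieldType).
Variables (K : localField k Fq) (psi : k -> R[i]) (lam : int).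
Variables (W : vectType k) (beta : W -> W -> k).
Local Notation C := R[i].
Implicit Types (L A B : set W) (g : 'End(W)) (phi : W -> C).

Definition dual_lattice L : set W :=
  [set v | forall b, L b -> videal (lf_val K) lam (beta v b)].

Definition self_dual L : Prop := L = dual_lattice L.

Definition stabilizer L : set 'End(W) := Sp beta `&` [set g | g @` L = L].

(* A system of representatives of [M / L]. *)
Definition reps (M L : set W) : set W :=
  [set xget 0 [set x | M x /\ L (x - a)] | a in M].

Definition lat_index (M L : set W) : nat := #|` fset_set (reps M L)|%fset.

(* The squared norm: [|phi|^2] integrated over the discrete space [W / A]. *)
Definition sqnorm A phi : \bar R :=
  \esum_(w in reps setT A) (complex.Re (`|phi w| ^+ 2))%:E.

Definition hilbert A : set (W -> C) :=
  [set phi | (forall a w, A a ->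
                phi (a + w) = psi (2^-1 * beta w a) * phi w)
             /\ (sqnorm A phi < +oo)%E].

Definition heisenberg (w : W) (t : k) phi : W -> C :=
  fun w' => psi (t + 2^-1 * beta w' w) * phi (w' + w).

(* Operators are only considered through their values on [hilbert A]. *)
Local Notation operator := ((W -> C) -> (W -> C)).

Definition unitary A (U : operator) : Prop :=
  [/\ forall phi, hilbert A phi -> hilbert A (U phi),
      forall (c : C) phi phi', hilbert A phi -> hilbert A phi' ->
        U (fun w => c * phi w + phi' w) = (fun w => c * U phi w + U phi' w),
      forall phi, hilbert A phi -> sqnorm A (U phi) = sqnorm A phi
    & forall phi, hilbert A phi -> exists2 phi', hilbert A phi' & U phi' = phi].

Definition intertwiners A : set ('End(W) * operator) :=
  [set x | [/\ Sp beta x.1, unitary A x.2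
     & forall w t phi, hilbert A phi ->
         x.2 (heisenberg w t phi) = heisenberg (x.1 w) t (x.2 phi)]].

Definition same_op A (U V : operator) : Prop :=
  forall phi, hilbert A phi -> U phi = V phi.

(* [M] is the group Mp(W), realized on [hilbert A]; it contains the image of
   [weil_section]. *)
Definition metaplectic A (M : set ('End(W) * operator)) : Prop :=
  [/\ M `<=` intertwiners A,
      (forall g U V, M (g, U) -> same_op A U V -> M (g, V)),
      [/\ M (\1%VF, id),
          forall g h U V, M (g, U) -> M (h, V) -> M ((g \o h)%VF, U \o V)
        & forall g U, M (g, U) -> exists2 V, M ((g^-1)%VF, V)
            & same_op A (U \o V) id],
      (forall g, Sp beta g -> exists U, M (g, U))
    & exists2 U0, M (\1%VF, U0) /\ ~ same_op A U0 id
        & forall U, M (\1%VF, U) -> same_op A U id \/ same_op A U U0].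

(* The Weil representation of Mp(W). *)
Definition weil (x : 'End(W) * operator) : operator := x.2.

(* The residual symplectic space [B^* / B], presented by a projection of [B^*]
   onto an [Fq]-vector space with kernel [B], together with its reduced form and
   its Lagrangian [A / B]. The map [rs_pr] is meaningful on [B^*] only. *)
Record residualSpace A B := ResidualSpace {
  rs_space : vectType Fq;
  rs_pr : W -> rs_space;
  rs_form : rs_space -> rs_space -> Fq;
  rs_lagr : {vspace rs_space};
  rs_prD : {in dual_lattice B &, {morph rs_pr : x y / x + y}};
  rs_prZ : forall c x, lf_int K c -> dual_lattice B x ->
    rs_pr (c *: x) = lf_red K c *: rs_pr x;
  rs_pr_surj : forall y, exists2 x, dual_lattice B x & rs_pr x = y;
  rs_pr_ker : forall x, dual_lattice B x -> (rs_pr x = 0 <-> B x);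
  rs_formE : forall x y, dual_lattice B x -> dual_lattice B y ->
    rs_form (rs_pr x) (rs_pr y) = lf_red K (lf_unif K ^ (1 - lam) * beta x y);
  rs_lagrE : forall y, y \in rs_lagr <-> exists2 a, A a & rs_pr a = y }.
Arguments rs_form {A B} _ _ _.

Section Residual.
Variables (A B : set W) (Q : residualSpace A B).
Local Notation b := (rs_space Q).
Local Notation x := (rs_lagr Q).
Implicit Types (h p : 'End(b)) (theta : 'End(b) -> Fq).

(* The image in Sp(B^* / B) of an element of the stabilizer of [B]. *)
Definition reduction g : 'End(b) :=
  linfun (fun y =>
    rs_pr Q (g (xget 0 [set w | dual_lattice B w /\ rs_pr Q w = y]))).

Definition rs_l : nat := (\dim {: b})./2.

Definition rs_j h : nat := rs_l - \dim (x :&: (h @: x)).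

Definition siegel : set 'End(b) :=
  Sp (rs_form Q) `&` [set p | (p @: x)%VS = x].

Definition det_on (U : {vspace b}) p : Fq :=
  \det (\matrix_(i < \dim U, j < \dim U)
          coord (vbasis U) j (p (vbasis U)`_i)).

Definition eq_mod_squares (c d : Fq) : Prop := exists2 s, s != 0 & c = d * s ^+ 2.

Definition symplectic_basis (e f : 'I_rs_l -> b) : Prop :=
  [/\ <<codom e>>%VS = x, <<codom e ++ codom f>>%VS = {: b}%VS,
      forall i j, rs_form Q (e i) (f j) = (i == j)%:R,
      forall i j, rs_form Q (e i) (e j) = 0
    & forall i j, rs_form Q (f i) (f j) = 0].

(* [theta] takes values in representatives of classes modulo squares. *)
Definition theta_function theta : Prop :=
  [/\ forall h, Sp (rs_form Q) h -> theta h != 0,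
      forall p1 h p2, siegel p1 -> Sp (rs_form Q) h -> siegel p2 ->
        eq_mod_squares (theta (p1 \o h \o p2)%VF)
                       (theta p1 * theta h * theta p2),
      forall p, siegel p -> eq_mod_squares (theta p) (det_on x p)
    & exists e f, symplectic_basis e f /\
        forall (S : {set 'I_rs_l}) (tau : 'End(b)),
          (forall i, i \in S -> tau (e i) = f i /\ tau (f i) = - e i) ->
          (forall i, i \notin S -> tau (e i) = e i /\ tau (f i) = f i) ->
          eq_mod_squares (theta tau) 1].

Definition psibar (y : Fq) : C :=
  psi (lf_unif K ^ (lam - 1) * xget 0 [set z | lf_int K z /\ lf_red K z = y]).

Definition omega (a : Fq) : C :=
  (sqrtC #|Fq|%:R)^-1 * \sum_(t : Fq) psibar (2^-1 * a * t ^+ 2).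

Definition mfactor theta h : C :=
  (omega (theta h))^-1 * omega 1 ^ (1 - (rs_j h)%:Z).

Definition weil_op theta g phi : W -> C := fun w =>
  mfactor theta (reduction g) * sqrtC #|Fq|%:R ^+ rs_j (reduction g)
  * ((lat_index A (A `&` g @` A))%:R)^-1
  * \sum_(a \in reps A (A `&` g @` A))
      psi (2^-1 * beta a w) * phi ((g^-1)%VF (a + w)).

(* The section, meaningful over [stabilizer B]. *)
Definition weil_section theta g : 'End(W) * operator := (g, weil_op theta g).

(* [phi] is an eigenfunction of weight [chi] for the restriction to [T] of the
   Weil representation, [T] being lifted to Mp(W) by the section. *)
Definition eigenfunction theta (T : set 'End(W)) (chi : 'End(W) -> C) phi :
  Prop :=
  [/\ hilbert A phi, phi <> (fun=> 0)
    & forall t, T t ->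
        weil (weil_section theta t) phi = (fun w => chi t * phi w)].

Definition occurs theta (T : set 'End(W)) (chi : 'End(W) -> C) : Prop :=
  exists phi, eigenfunction theta T chi phi.

End Residual.
End Weil.

(** ** Irreducible tori and their lattices *)

Definition ext_trace (F : fieldType) (L : fieldExtType F) (x : L) : F :=
  \sum_(i < \dim {:L}) coord (vbasis {:L}) i (x * (vbasis {:L})`_i).

(* The identification of (W, T) with a quadratic extension k''/k' and its group
   of norm one elements; k' is given as a subfield [it_k1] of k'' = [it_k2]. *)
Record irreducibleTorus (k : fieldType) (Fq : finFieldType)
    (K : localField k Fq) (W : vectType k) (beta : W -> W -> k)
    (T : set 'End(W)) := IrreducibleTorus {
  it_k2 : fieldExtType k;
  it_k1 : {subfield it_k2};
  it_tau : {rmorphism it_k2 -> it_k2};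
  it_v1 : subvs_of it_k1 -> int;
  it_v2 : it_k2 -> int;
  it_e : nat;
  it_e2 : nat;
  it_delta : int;
  it_unif1 : subvs_of it_k1;
  it_unif2 : it_k2;
  it_u : it_k2;
  it_iso : 'Hom(W, it_k2);
  it_dim1 : (2 * \dim it_k1 = \dim {:W})%N;
  it_dim2 : (\dim {: it_k2} = 2 * \dim it_k1)%N;
  it_tauK : involutive it_tau;
  it_tau_fix : forall x, x \in it_k1 <-> it_tau x = x;
  it_v1P : normalized_valuation it_v1;
  it_v2P : normalized_valuation it_v2;
  it_eP : (0 < it_e)%N /\ forall c : k, c != 0 ->
    it_v1 (c%:A) = it_e%:Z * lf_val K c;
  it_e2P : (0 < it_e2)%N /\ forall x : subvs_of it_k1, x != 0 ->
    it_v2 (vsval x) = it_e2%:Z * it_v1 x;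
  (* Automatic, by uniqueness of the extension of a complete valuation. *)
  it_v2_tau : forall x, it_v2 (it_tau x) = it_v2 x;
  (* The inverse different is the dual of the integers for the trace. *)
  it_deltaP : forall x : subvs_of it_k1,
    (forall y, videal it_v1 0 y -> lf_int K (ext_trace (x * y)))
    <-> videal it_v1 (- it_delta) x;
  it_unif1P : it_unif1 != 0 /\ it_v1 it_unif1 = 1;
  it_unif2P : it_unif2 != 0 /\ it_v2 it_unif2 = 1;
  it_unif : if it_e2 == 1%N then it_unif2 = vsval it_unif1
            else it_unif2 ^+ 2 = vsval it_unif1;
  it_uP : it_u != 0 /\ it_u + it_tau it_u = 0;
  it_u_val : if it_e2 == 1%N then it_v2 it_u = 0 \/ it_v2 it_u = 1
             else it_u = it_unif2;
  it_isoP : bijective it_iso;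
  it_formE : forall x y,
    beta x y = 2^-1 * ext_trace (it_u * it_tau (it_iso x) * it_iso y);
  it_torusE : forall g, T g <->
    exists2 t, t * it_tau t = 1 & forall x, it_iso (g x) = t * it_iso x }.
Arguments it_v1 {k Fq K W beta T} _ _.
Arguments it_v2 {k Fq K W beta T} _ _.

Section TorusLattices.
Variables (k : fieldType) (Fq : finFieldType) (K : localField k Fq).
Variables (lam : int) (W : vectType k) (beta : W -> W -> k).
Variables (T : set 'End(W)) (D : irreducibleTorus K beta T).

Definition it_ramified : bool := it_e2 D != 1%N.

Definition it_mu : int := (it_e D)%:Z * lam - it_delta D - it_v2 D (it_u D).

(* The lattices, transported to [W] along the identification. *)
Definition it_B : set W :=
  [set w | exists2 y, videal (it_v2 D) 0 y &
     it_iso D w =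
       (if it_ramified then it_unif2 D ^ it_mu
        else vsval (it_unif1 D) ^ ((it_mu + 1) %/ 2)%Z) * y].

Definition it_nu : it_k2 D :=
  it_u D * vsval (it_unif1 D) ^ (- it_v2 D (it_u D)).

Definition it_A : set W :=
  [set w | (self_dual K lam beta it_B /\ it_B w) \/
     (~ self_dual K lam beta it_B /\
      exists y z : subvs_of (it_k1 D),
        [/\ videal (it_v1 D) 0 y, videal (it_v1 D) 0 z
          & it_iso D w = vsval (it_unif1 D) ^ ((it_mu - 1) %/ 2)%Z
              * (vsval y + vsval z * vsval (it_unif1 D) * it_nu)])].

End TorusLattices.

(** ** Orthogonal decompositions *)

Section Decomposition.
Variables (k : fieldType) (W : vectType k) (beta : W -> W -> k).
Variables (T : set 'End(W)) (n : nat) (Ws : 'I_n -> {vspace W}).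

Definition sub_form (i : 'I_n) (x y : subvs_of (Ws i)) : k :=
  beta (vsval x) (vsval y).

Definition restr (i : 'I_n) (g : 'End(W)) : 'End(subvs_of (Ws i)) :=
  linfun (fun x => vsproj (Ws i) (g (vsval x))).

Definition sub_torus (i : 'I_n) : set 'End(subvs_of (Ws i)) :=
  restr i @` T.

Definition component (i : 'I_n) (w : W) : subvs_of (Ws i) :=
  vsproj (Ws i) (sumv_pi (\sum_(j < n) Ws j)%VS i w).

(* The embedding of [T_i] in [T]: the identity on the other summands. *)
Definition embed (i : 'I_n) (t : 'End(subvs_of (Ws i))) : 'End(W) :=
  linfun (fun w => w - vsval (component i w) + vsval (t (component i w))).

Definition torus_decomposition : Prop :=
  [/\ (\sum_(i < n) Ws i)%VS = {:W}%VS /\ directv (\sum_(i < n) Ws i),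
      (forall i j, i != j -> forall x y, x \in Ws i -> y \in Ws j ->
         beta x y = 0),
      (forall i, symplectic_form (@sub_form i)),
      (forall i, [/\ Ws i != 0%VS, (forall t, T t -> (t @: Ws i <= Ws i)%VS)
         & forall U : {vspace W}, (U <= Ws i)%VS ->
             (forall t, T t -> (t @: U <= U)%VS) -> U = 0%VS \/ U = Ws i])
      (* restriction identifies [T] with the product of the [T_i] *)
    & forall t : forall i, 'End(subvs_of (Ws i)),
        (forall i, @sub_torus i (t i)) ->
        exists2 g, T g & forall i, restr i g = t i].

Definition sum_lattice (L : forall i, set (subvs_of (Ws i))) : set W :=
  [set w | forall i, L i (component i w)].

Definition tensor (R : realType) (phi : forall i, subvs_of (Ws i) -> R[i]) :
  W -> R[i] := fun w => \prod_(i < n) phi i (component i w).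

End Decomposition.

Arguments sub_form {k W} beta {n} Ws i x y.
Arguments sub_torus {k W} T {n} Ws i _.
Arguments component {k W n} Ws i w.
Arguments embed {k W n} Ws i t.

(* Main.v *)
Require Import Defs.
From HB Require Import structures.
From mathcomp Require Import all_boot all_order all_algebra all_field.
From mathcomp Require Import finmap.
From mathcomp Require Import boolp classical_sets functions cardinality fsbigop.
From mathcomp Require Import reals constructive_ereal ereal esum.
From mathcomp Require Import complex.
From mathcomp Require Import zify ring.
Set Implicit Arguments.
Unset Strict Implicit.
Unset Printing Implicit Defensive.
Import Order.TTheory GRing.Theory Num.Theory.
Local Open Scope classical_set_scope.
Local Open Scope ring_scope.

(** Everything rests on the factorization S(g) (phi_1 (x) ... (x) phi_n) =
    S_1(g_1) phi_1 (x) ... (x) S_n(g_n) phi_n for g = (g_1, ..., g_n) in T. The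
    sum over A / (A n gA) splits because A and gA are direct sums of lattices of
    the W_i, so the point is the factorization of the scalar. Over the finite
    field, omega(a) / omega(1) is multiplicative on classes modulo squares, hence
    it suffices that j is additive and that theta is multiplicative for the
    decomposition of B^* / B. Both invariants are read off a normal form: if
    (E, G) is a symplectic basis of B^* / B with E spanning x, and if h maps E to
    the columns of C in the basis obtained from E by replacing E_s by G_s for s
    in S, then theta(h) = det C modulo squares and j(h) = #|S|; such normal forms
    add up. One exists for each g_i because an irreducible torus leaves two
    possibilities: g_i stabilizes A_i, or A_i n g_i A_i = B_i.

    Weights are multiplicative over the T_i, so a tensor product of eigenfunctions
    is an eigenfunction. Conversely, if phi(w_0) <> 0, restricting an
    eigenfunction phi to the coset w_0 + W_i gives an eigenfunction for T_i. *)

(** * Bases, determinants and symplectic bases *)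

(** [theta] and the [thetas i] are given independently, each by axioms tied to one symplectic basis,
    and the basis for [theta] need not respect the decomposition. This is why normal forms are taken
    relative to any symplectic basis whose first half spans the Lagrangian: passing between two such
    bases is an element of the Siegel parabolic, where [theta] is a determinant.

    The exponent [1 - j] in the scalar supplies the omega(1) that normalizes omega: m(h) =
    (omega(theta(h)) / omega(1))^-1 omega(1)^(-j), a character of theta(h) times a factor depending
    on j exponentially.

    The representatives chosen for A / (A n gA) are not sums of those chosen in the W_i. The sums
    must therefore be shown independent of representatives, which holds because psi is trivial on
    beta(A, A).

    For the restriction to a coset of W_i, the element of T attached to an element of T_i is the
    identity on the other summands, so the factorization of the scalar applies with m(1) = 1
    there. *)

Lemma det_mxdiag (R : comNzRingType) n (l : 'I_n -> nat)
    (C : forall i, 'M[R]_(l i)) :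
  \det (\mxdiag_i C i) = \prod_i \det (C i).
Proof.
elim: n l C => [|n IHn] l C.
  rewrite [RHS]big_ord0; move: (\mxdiag_i C i); rewrite big_ord0 => M.
  exact: det_mx00.
rewrite mxdiag_recl [RHS]big_ord_recl -IHn -(det_ublock _ 0).
by case: _ / mxsize_recl; rewrite castmx_id.
Qed.

Section BasisChange.
Variables (F : fieldType) (V : vectType F).

(** Packages a function whose linearity is only a hypothesis, such as a form with one argument
    fixed, so that the general lemmas on linear maps apply to it. *)
Lemma linear_funE (V' : lmodType F) (f : V -> V') (fP : linear f) :
  exists2 g : {linear V -> V'}, f =1 g & (g : V -> V') = f.
Proof.
pose g : {linear V -> V'} :=
  HB.pack f (GRing.isLinear.Build F V V' *:%R f fP).
by exists g.
Qed.

Lemma linfunE (V' : vectType F) (f : V -> V') : linear f -> linfun f =1 f.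
Proof. by move=> /linear_funE[g _ <-] v; rewrite lfunE. Qed.

(** [l] and [\dim U] are equal but not convertible, so the change of basis is expressed by two
    rectangular matrices inverse to each other. This is enough for the trace, which is cyclic even
    for rectangular products. *)
Lemma coord_matrix_conj (U : {vspace V}) l (X : l.-tuple V) (p : 'End(V))
    (C : 'M[F]_l) :
  basis_of U X -> (forall k : 'I_l, p X`_k = \sum_j C j k *: X`_j) ->
  exists M N, [/\ M *m N = 1%:M, N *m M = 1%:M &
    \matrix_(i < \dim U, j < \dim U)
      coord (vbasis U) j (p (vbasis U)`_i) = M *m C^T *m N].
Proof.
move=> bX pX; have bU := vbasisP U.
pose M := \matrix_(i < \dim U, k < l) coord X k (vbasis U)`_i.
pose N := \matrix_(k < l, j < \dim U) coord (vbasis U) j X`_k.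
have memX k : X`_k \in U \/ (l <= k)%N.
  case: (leqP l k) => hk; [by right | left].
  by rewrite (basis_mem bX) // mem_nth // size_tuple.
have memX' (k : 'I_l) : X`_k \in U.
  by case: (memX k) => //; rewrite leqNgt ltn_ord.
have memU (k : 'I_(\dim U)) : (vbasis U)`_k \in U.
  by rewrite (basis_mem bU) // mem_nth // size_tuple.
have XE (k : 'I_l) : X`_k = \sum_j N k j *: (vbasis U)`_j.
  rewrite {1}(coord_basis bU (memX' k)).
  by apply: eq_bigr => j _; rewrite mxE.
have UE (i : 'I_(\dim U)) : (vbasis U)`_i = \sum_k M i k *: X`_k.
  rewrite {1}(coord_basis bX (memU i)).
  by apply: eq_bigr => j _; rewrite mxE.
exists M, N; split.
- apply/matrixP=> i j; rewrite !mxE -(coord_free i j (basis_free bU)) (UE i).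
  by rewrite linear_sum; apply: eq_bigr => k _; rewrite linearZ /= !mxE.
- apply/matrixP=> i j; rewrite !mxE -(coord_free i j (basis_free bX)).
  rewrite (XE i) linear_sum; apply: eq_bigr => k _.
  by rewrite linearZ /= !mxE.
- apply/matrixP=> i j; rewrite mxE {1}(UE i) !linear_sum !mxE.
  under [RHS]eq_bigr do rewrite !mxE big_distrl /=.
  rewrite exchange_big; apply: eq_bigr => k _.
  rewrite linearZ /= linearZ /= pX linear_sum big_distrr; apply: eq_bigr => m _.
  by rewrite linearZ /= !mxE mulrA.
Qed.

Lemma det_vbasis (U : {vspace V}) l (X : l.-tuple V) (p : 'End(V))
    (C : 'M[F]_l) :
  basis_of U X -> (forall k : 'I_l, p X`_k = \sum_j C j k *: X`_j) ->
  \det (\matrix_(i < \dim U, j < \dim U)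
          coord (vbasis U) j (p (vbasis U)`_i)) = \det C.
Proof.
move=> bX pX; have [M [N [MN _ ->]]] := coord_matrix_conj bX pX.
have lE := size_basis bX;
(* The determinants of [M] and [N] make sense only once [l] has been replaced by [\dim U]. *)
clear bX pX; subst l; rewrite !det_mulmx det_tr mulrAC -det_mulmx MN.
by rewrite det1 mul1r.
Qed.

Lemma trace_vbasis (U : {vspace V}) l (X : l.-tuple V) (p : 'End(V))
    (C : 'M[F]_l) :
  basis_of U X -> (forall k : 'I_l, p X`_k = \sum_j C j k *: X`_j) ->
  \sum_(i < \dim U) coord (vbasis U) i (p (vbasis U)`_i) = \tr C.
Proof.
move=> bX pX; have [M [N [_ NM E]]] := coord_matrix_conj bX pX.
transitivity (\tr (M *m C^T *m N)).
  by rewrite -E; apply: eq_bigr => i _; rewrite mxE.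
by rewrite mxtrace_mulC mulmxA NM mul1mx mxtrace_tr.
Qed.

Lemma span_mapP (I : eqType) (X : I -> V) (s : seq I) v :
  uniq s -> v \in <<map X s>>%VS -> exists c, v = \sum_(i <- s) c i *: X i.
Proof.
elim: s v => [|i s IHs] v /=.
  by rewrite span_nil memv0 => _ /eqP->; exists (fun=> 0); rewrite big_nil.
case/andP=> nis us; rewrite span_cons => /memv_addP[_ /vlineP[a ->] [w ws ->]].
have [c ->] := IHs _ us ws; exists (fun j => if j == i then a else c j).
rewrite big_cons eqxx; congr (_ + _).
apply: eq_big_seq => j js.
by case: eqP => // E; rewrite -E js in nis.
Qed.

Lemma span_codomP l (X : 'I_l -> V) v :
  reflect (exists c, v = \sum_i c i *: X i) (v \in <<codom X>>%VS).
Proof.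
apply: (iffP idP) => [/span_mapP[|c ->]|[c ->]]; first exact: enum_uniq.
  by exists c; rewrite big_enum.
apply: memv_suml => i _; apply: memvZ; apply: memv_span; exact: codom_f.
Qed.

(** The functionals [d i] detect coefficients, so the family is free. For half of a symplectic basis
    they are the pairings with the other half. *)
Lemma dim_span_dual (I : eqType) (X : I -> V) (d : I -> V -> F) (s : seq I) :
  uniq s -> (forall i a v w, d i (a *: v + w) = a * d i v + d i w) ->
  (forall i j, d i (X j) = (i == j)%:R) -> \dim <<map X s>>%VS = size s.
Proof.
move=> us dL dX; rewrite -(size_map X); apply/eqP.
change (free (map X s)).
elim: s us => [|i s IHs] /=; first by rewrite nil_free.
case/andP=> nis us; rewrite free_cons IHs // andbT; apply/negP=> h.
have [c Xi] := span_mapP us h.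
have [d' dE dE'] := linear_funE (V' := F^o) (dL i).
have: d i (X i) = 0.
  rewrite dE Xi linear_sum big_seq big1 // => j js.
  by rewrite linearZ /= -dE dX; case: eqP js nis => [->->//|]; rewrite scaler0.
by rewrite dX eqxx => /eqP; rewrite oner_eq0.
Qed.

End BasisChange.

Section SymplecticBases.
Variables (F : fieldType) (V : vectType F) (form : V -> V -> F).
Hypothesis formL : forall a x y z, form (a *: x + y) z = a * form x z + form y z.
Hypothesis formC : forall x y, form x y = - form y x.

Lemma sformR a x y z : form z (a *: x + y) = a * form z x + form z y.
Proof. by rewrite ![form z _]formC formL opprD mulrN. Qed.

Lemma sform_sumL (I : finType) (c : I -> F) (X : I -> V) z :
  form (\sum_i c i *: X i) z = \sum_i c i * form (X i) z.
Proof.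
have [f fE _] := linear_funE (V' := F^o) (fun a x y => formL a x y z).
by rewrite fE linear_sum; apply: eq_bigr => i _; rewrite linearZ /= -fE.
Qed.

Lemma sform_sumR (I : finType) (c : I -> F) (X : I -> V) z :
  form z (\sum_i c i *: X i) = \sum_i c i * form z (X i).
Proof.
rewrite formC sform_sumL -sumrN; apply: eq_bigr => i _.
by rewrite -mulrN -formC.
Qed.

Lemma sformDl x y z : form (x + y) z = form x z + form y z.
Proof. by rewrite -[x]scale1r formL mul1r scale1r. Qed.

Lemma sformDr x y z : form z (x + y) = form z x + form z y.
Proof. by rewrite -[x]scale1r sformR mul1r scale1r. Qed.

Lemma sformNl x z : form (- x) z = - form x z.
Proof.
have [f fE _] := linear_funE (V' := F^o) (fun a x y => formL a x y z).
by rewrite !fE linearN.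
Qed.

Lemma sform0l z : form 0 z = 0.
Proof. by rewrite -(subrr 0) sformDl sformNl subrr. Qed.

Lemma sformNr x z : form z (- x) = - form z x.
Proof. by rewrite formC sformNl -formC. Qed.

(** Spanning is stated as an expansion with the pairings as coefficients. The size [l] is left free,
    since a glued basis is indexed by a sum of sizes. *)
Definition sbasis l (e f : 'I_l -> V) : Prop :=
  [/\ forall v, v = \sum_i form v (f i) *: e i + \sum_i form (e i) v *: f i,
      forall i j, form (e i) (f j) = (i == j)%:R,
      forall i j, form (e i) (e j) = 0
    & forall i j, form (f i) (f j) = 0].

Lemma sum_delta l (c : 'I_l -> F) j : \sum_i c i * (i == j)%:R = c j.
Proof.
rewrite (bigD1 j) //= eqxx mulr1 big1 ?addr0 // => i /negPf->.
by rewrite mulr0.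
Qed.

Lemma sum_deltaZ l (X : 'I_l -> V) j : \sum_i (i == j)%:R *: X i = X j.
Proof.
rewrite (bigD1 j) //= eqxx scale1r big1 ?addr0 // => i /negPf->.
by rewrite scale0r.
Qed.

Lemma sbasis_span l (e f : 'I_l -> V) :
  (<<codom e ++ codom f>> = {:V})%VS ->
  (forall i j, form (e i) (f j) = (i == j)%:R) ->
  (forall i j, form (e i) (e j) = 0) ->
  (forall i j, form (f i) (f j) = 0) -> sbasis e f.
Proof.
move=> sp ef ee ff; split=> // v.
have: v \in <<codom e ++ codom f>>%VS by rewrite sp memvf.
rewrite span_cat => /memv_addP[_ /span_codomP[a ->] [_ /span_codomP[b ->] ->]].
congr (_ + _); apply: eq_bigr => i _; congr (_ *: _).
  rewrite sformDl !sform_sumL; under eq_bigr do rewrite ef.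
  by rewrite sum_delta big1 ?addr0 // => j _; rewrite ff mulr0.
rewrite sformDr !sform_sumR addrC; under eq_bigr do rewrite ef eq_sym.
by rewrite sum_delta big1 ?addr0 // => j _; rewrite ee mulr0.
Qed.

Section OneBasis.
Variables (l : nat) (e f : 'I_l -> V).
Hypothesis ef : sbasis e f.

Lemma sbasis_dim : \dim {:V} = l.*2.
Proof.
have [ex efE ee ff] := ef.
pose X (s : 'I_l + 'I_l) := match s with inl i => e i | inr i => f i end.
pose d (s : 'I_l + 'I_l) v :=
  match s with inl i => form v (f i) | inr i => form (e i) v end.
pose s := enum (predT : pred ('I_l + 'I_l)%type).
have -> : {:V}%VS = <<map X s>>%VS.
  apply/esym/eqP; rewrite eqEsubv subvf; apply/subvP=> v _; rewrite (ex v).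
  by apply: memvD; apply: memv_suml => i _; apply/memvZ/memv_span;
    [apply: (map_f X (x := inl i)) | apply: (map_f X (x := inr i))];
    rewrite mem_enum.
rewrite (dim_span_dual (d := d)) ?enum_uniq //.
- by rewrite -cardE card_sum card_ord addnn.
- by move=> [i|i] a v w /=; rewrite ?formL ?sformR.
- move=> [i|i] [j|j] /=; rewrite ?efE ?ee ?ff //.
  by rewrite eq_sym.
Qed.

Lemma sbasis_dim_lagr : \dim <<codom e>>%VS = l.
Proof.
have [ex efE ee ff] := ef.
rewrite (dim_span_dual (d := fun i v => form v (f i))) ?enum_uniq //.
- by rewrite -cardE card_ord.
- by move=> i j; rewrite efE eq_sym.
Qed.

(** The coefficients of [v] on [f] are its pairings with [e], so the span of [e] is its own
    orthogonal. *)
Lemma mem_lagr v : (v \in <<codom e>>%VS) <-> forall i, form (e i) v = 0.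
Proof.
have [ex efE ee ff] := ef; split.
  case/span_codomP=> c -> i; rewrite sform_sumR big1 // => j _.
  by rewrite ee mulr0.
move=> ev; rewrite (ex v) [X in _ + X]big1 ?addr0.
  by apply/span_codomP; exists (fun i => form v (f i)).
by move=> i _; rewrite ev scale0r.
Qed.

Lemma sbasis_formE v w :
  form v w = \sum_i form v (f i) * form (e i) w
             - \sum_i form (e i) v * form w (f i).
Proof.
have [ex efE ee ff] := ef.
rewrite {1}(ex v) sformDl !sform_sumL; congr (_ + _).
by rewrite -sumrN; apply: eq_bigr => i _; rewrite -mulrN -formC.
Qed.

Lemma sbasis_nondegenerate v : (forall w, form v w = 0) -> v = 0.
Proof.
have [ex _ _ _] := ef => h; rewrite (ex v).
rewrite !big1 ?addr0 // => i _; first by rewrite formC h oppr0 scale0r.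
by rewrite h scale0r.
Qed.

Lemma isometry_inj (g : 'End(V)) :
  (forall x y, form (g x) (g y) = form x y) -> lker g == 0%VS.
Proof.
move=> gP; apply/lker0P=> x y E; apply/eqP; rewrite -subr_eq0; apply/eqP.
apply: sbasis_nondegenerate => w; rewrite -gP linearB /= E subrr.
by rewrite sform0l.
Qed.

(** This is the image of [(e, f)] under [tau_S]; the sign keeps the pairing of the exchanged vectors
    equal to 1. *)
Lemma sbasis_twist (S : {set 'I_l}) :
  sbasis (fun i => if i \in S then f i else e i)
         (fun i => if i \in S then - e i else f i).
Proof.
have [ex efE ee ff] := ef.
have nSS i j : i \in S -> (j \in S) = false -> i != j.
  by move=> iS jS; apply/eqP=> E; rewrite E jS in iS.
split.
- move=> v; rewrite {1}(ex v) -!big_split; apply: eq_bigr => i _ /=.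
  case: ifP => _ //; rewrite addrC [form (f i) v]formC sformNr scalerN.
  by rewrite !scaleNr opprK formC scaleNr -scaleNr -formC.
- move=> i j; case: ifP => iS; case: ifP => jS.
  + by rewrite sformNr formC opprK efE eq_sym.
  + by rewrite ff (negPf (nSS _ _ iS jS)).
  + by rewrite sformNr ee oppr0 eq_sym (negPf (nSS _ _ jS iS)).
  + by rewrite efE.
- move=> i j; case: ifP => iS; case: ifP => jS; rewrite ?ee ?ff ?efE //.
    by rewrite formC efE eq_sym (negPf (nSS _ _ iS jS)) oppr0.
  by rewrite eq_sym (negPf (nSS _ _ jS iS)).
- move=> i j; case: ifP => iS; case: ifP => jS; rewrite ?sformNl ?sformNr ?ee
    ?ff ?efE ?oppr0 //.
    by rewrite (negPf (nSS _ _ iS jS)) oppr0.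
  by rewrite formC efE (negPf (nSS _ _ jS iS)) !oppr0.
Qed.

End OneBasis.

(** The difference between [v] and its would-be expansion is orthogonal to [e], hence lies in the
    span of [e]; its pairings with [G] also vanish, so its coefficients are 0. *)
Lemma sbasis_compl l (e f G : 'I_l -> V) : sbasis e f ->
  (forall i j, form (e i) (G j) = (i == j)%:R) ->
  (forall i j, form (G i) (G j) = 0) -> sbasis e G.
Proof.
move=> ef eG GG; have [_ _ ee _] := ef; split=> // v.
pose v' := \sum_i form v (G i) *: e i + \sum_i form (e i) v *: G i.
apply/eqP; rewrite -subr_eq0 -/v'; apply/eqP.
have vG j : form v' (G j) = form v (G j).
  rewrite sformDl !sform_sumL; under eq_bigr do rewrite eG.
  by rewrite sum_delta big1 ?addr0 // => i _; rewrite GG mulr0.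
have ev j : form (e j) v' = form (e j) v.
  rewrite sformDr !sform_sumR addrC; under eq_bigr do rewrite eG eq_sym.
  by rewrite sum_delta big1 ?addr0 // => i _; rewrite ee mulr0.
have /(mem_lagr ef)/span_codomP[c dE] : forall i, form (e i) (v - v') = 0.
  by move=> i; rewrite sformDr sformNr ev subrr.
rewrite dE big1 // => i _; suff -> : c i = 0 by rewrite scale0r.
have : form (v - v') (G i) = 0 by rewrite sformDl sformNl vG subrr.
by rewrite dE sform_sumL; under eq_bigr do rewrite eG; rewrite sum_delta.
Qed.

Definition smap l (e f E G : 'I_l -> V) : 'End(V) :=
  linfun (fun v => \sum_i form v (f i) *: E i + \sum_i form (e i) v *: G i).

Section TwoBases.
Variables (l : nat) (e f E G : 'I_l -> V).
Hypotheses (ef : sbasis e f) (EG : sbasis E G).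

Lemma smapE v :
  smap e f E G v = \sum_i form v (f i) *: E i + \sum_i form (e i) v *: G i.
Proof.
rewrite linfunE // => a x y; rewrite scalerDr !scaler_sumr -!big_split.
apply: eq_bigr => i _ /=.
by rewrite formL sformR !scalerDl !scalerA addrACA.
Qed.

Lemma smap_e i : smap e f E G (e i) = E i.
Proof.
have [_ efE ee _] := ef; rewrite smapE.
under eq_bigr do rewrite efE eq_sym.
rewrite sum_deltaZ big1 ?addr0 // => j _; by rewrite ee scale0r.
Qed.

Lemma smap_f i : smap e f E G (f i) = G i.
Proof.
have [_ efE _ ff] := ef; rewrite smapE addrC.
under eq_bigr do rewrite efE.
rewrite sum_deltaZ big1 ?addr0 // => j _; by rewrite ff scale0r.
Qed.

Lemma smap_isometry x y : form (smap e f E G x) (smap e f E G y) = form x y.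
Proof.
have [_ EGE EE GG] := EG.
have hG v i : form (smap e f E G v) (G i) = form v (f i).
  rewrite smapE sformDl !sform_sumL; under eq_bigr do rewrite EGE.
  by rewrite sum_delta big1 ?addr0 // => j _; rewrite GG mulr0.
have hE v i : form (E i) (smap e f E G v) = form (e i) v.
  rewrite smapE sformDr !sform_sumR addrC; under eq_bigr do rewrite EGE eq_sym.
  by rewrite sum_delta big1 ?addr0 // => j _; rewrite EE mulr0.
rewrite (sbasis_formE EG) (sbasis_formE ef).
by congr (_ - _); apply: eq_bigr => i _; rewrite hG hE.
Qed.

End TwoBases.

Lemma smapK l (e f E G : 'I_l -> V) : sbasis e f -> sbasis E G ->
  (smap E G e f \o smap e f E G)%VF = \1%VF.
Proof.
move=> ef EG; have [ex _ _ _] := ef; apply/lfunP=> v.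
rewrite comp_lfunE id_lfunE (smapE e f) linearD !linear_sum {3}(ex v).
by congr (_ + _); apply: eq_bigr => i _; rewrite linearZ /= ?smap_e ?smap_f.
Qed.

End SymplecticBases.

(** * The function theta in normal form *)

Section ModSquares.
Variable F : finFieldType.
Implicit Types c d : F.

Lemma eq_mod_squares_refl c : eq_mod_squares c c.
Proof. by exists 1; rewrite ?oner_eq0 // expr1n mulr1. Qed.

Lemma eq_mod_squares_sym c d : eq_mod_squares c d -> eq_mod_squares d c.
Proof.
move=> [s s0 ->]; exists s^-1; first by rewrite invr_eq0.
by rewrite -mulrA -exprMn divff // expr1n mulr1.
Qed.

Lemma eq_mod_squares_trans c d e :
  eq_mod_squares c d -> eq_mod_squares d e -> eq_mod_squares c e.
Proof.
move=> [s s0 ->] [t t0 ->]; exists (t * s); first by rewrite mulf_neq0.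
by rewrite exprMn -mulrA.
Qed.

Lemma eq_mod_squaresM c c' d d' : eq_mod_squares c c' ->
  eq_mod_squares d d' -> eq_mod_squares (c * d) (c' * d').
Proof.
move=> [s s0 ->] [t t0 ->]; exists (s * t); first by rewrite mulf_neq0.
by rewrite exprMn mulrACA.
Qed.

Lemma eq_mod_squares_neq0 c d : eq_mod_squares c d -> c != 0 -> d != 0.
Proof. by move=> [s s0 ->]; rewrite mulf_eq0 negb_or => /andP[]. Qed.

End ModSquares.

Section Theta.
Variables (k : fieldType) (Fq : finFieldType) (K : localField k Fq) (lam : int).
Variables (W : vectType k) (beta : W -> W -> k) (A B : set W).
Variable Q : residualSpace K lam beta A B.
Local Notation b := (rs_space Q).
Local Notation x := (rs_lagr Q).
Local Notation form := (@rs_form _ _ _ _ _ _ _ _ Q).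
Hypothesis formL : forall a u v w, form (a *: u + v) w = a * form u w + form v w.
Hypothesis formC : forall u v, form u v = - form v u.

Lemma symplectic_basisP (e f : 'I_(rs_l Q) -> b) :
  symplectic_basis e f -> sbasis form e f /\ <<codom e>>%VS = x.
Proof.
move=> [ex sp ef ee ff]; split=> //.
apply: (sbasis_span formL formC sp ef ee ff).
Qed.

Lemma det_onE l (E G : 'I_l -> b) (p : 'End(b)) (C : 'M_l) :
  sbasis form E G -> <<codom E>>%VS = x ->
  (forall k, p (E k) = \sum_j C j k *: E j) -> det_on x p = \det C.
Proof.
move=> EG Ex pE.
apply: (@det_vbasis _ _ x l [tuple E i | i < l]).
  rewrite basisEdim -Ex (sbasis_dim_lagr formL EG) size_tuple leqnn andbT.
  by apply/subvP=> v; rewrite Ex -Ex.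
move=> i; rewrite (nth_map i) ?size_enum_ord // nth_ord_enum pE.
by apply: eq_bigr => j _; rewrite (nth_map i) ?size_enum_ord // nth_ord_enum.
Qed.

Lemma det_on_comp (p q : 'End(b)) l (E G : 'I_l -> b) :
  sbasis form E G -> <<codom E>>%VS = x ->
  (p @: x <= x)%VS -> (q @: x <= x)%VS ->
  det_on x (p \o q)%VF = det_on x p * det_on x q.
Proof.
move=> EG Ex px qx.
have mat (r : 'End(b)) : (r @: x <= x)%VS ->
    {C : 'M_l | forall k, r (E k) = \sum_j C j k *: E j}.
  move=> rx; have h m : {c | r (E m) = \sum_j c j *: E j}.
    apply: cid; apply/span_codomP; rewrite Ex; apply: (subvP rx).
    by apply: memv_img; rewrite -Ex; apply/memv_span/codom_f.
  exists (\matrix_(j, m) sval (h m) j) => m.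
  by rewrite (svalP (h m)); apply: eq_bigr => j _; rewrite mxE.
have [C pE] := mat p px; have [D qE] := mat q qx.
rewrite (det_onE EG Ex pE) (det_onE EG Ex qE) -det_mulmx.
apply: (det_onE EG Ex) => m; rewrite comp_lfunE qE linear_sum.
under eq_bigr do rewrite linearZ /= pE scaler_sumr.
rewrite exchange_big; apply: eq_bigr => j _ /=.
rewrite mxE scaler_suml; apply: eq_bigr => i _.
by rewrite scalerA mulrC.
Qed.

(** Since [theta] is known on [tau_S] only for its own basis [(e, f)], [h] is written as [p t r]:
    [p] carries [(e, f)] to [(E, G)], [t] is [tau_S], and [r] sends [E] to [e] through [C]. Both [p]
    and [r] preserve the Lagrangian, and [p r] has matrix [C] on [E], so the two determinants
    combine to [\det C] although neither is computed. *)
Lemma theta_normal_form (theta : 'End(b) -> Fq) l (E G : 'I_l -> b)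
    (S : {set 'I_l}) (C : 'M_l) (h : 'End(b)) :
  theta_function theta -> sbasis form E G -> <<codom E>>%VS = x ->
  Sp form h ->
  (forall m, h (E m) = \sum_j C j m *: (if j \in S then G j else E j)) ->
  eq_mod_squares (theta h) (\det C) /\ rs_j h = #|S|.
Proof.
move=> [theta0 thetaM thetad [e [f [/symplectic_basisP[ef ex] thetat]]]].
move=> EG Ex hS hE.
have lE : l = rs_l Q by rewrite /rs_l (sbasis_dim formL formC EG) doubleK.
subst l.
have ef' := sbasis_twist formL formC ef S.
have EG' := sbasis_twist formL formC EG S.
set g := (fun i => if i \in S then f i else e i) in ef'.
set g' := (fun i => if i \in S then - e i else f i) in ef'.
set H := (fun i => if i \in S then G i else E i) in EG'.
set H' := (fun i => if i \in S then - E i else G i) in EG'.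
pose p := smap form e f E G; pose t := smap form e f g g'.
pose r := (smap form g g' e f \o smap form E G e f \o h)%VF.
have pS : Sp form p by move=> u v; apply: smap_isometry.
have tS : Sp form t by move=> u v; apply: smap_isometry.
have rS : Sp form r.
  by move=> u v; rewrite !comp_lfunE !smap_isometry.
have hr : h = (p \o t \o r)%VF.
  rewrite /r -!comp_lfunA [(t \o _)%VF]comp_lfunA (smapK formL formC ef' ef).
  by rewrite comp_lfun1l comp_lfunA (smapK formL formC EG ef) comp_lfun1l.
have px : (p @: x)%VS = x.
  rewrite -{1}ex limg_span -map_comp -Ex; congr (<<_>>)%VS.
  by apply: eq_map => i /=; rewrite smap_e.
have rE m : r (E m) = \sum_j C j m *: e j.
  rewrite !comp_lfunE hE !linear_sum; apply: eq_bigr => j _.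
  rewrite linearZ /= linearZ /=; congr (_ *: _).
  have -> : smap form E G e f (if j \in S then G j else E j) = g j.
    by rewrite /g; case: ifP => _; rewrite ?smap_f ?smap_e.
  exact: smap_e.
have rx' : (r @: x <= x)%VS.
  rewrite -{1}Ex limg_span; apply/span_subvP=> v /mapP[_ /codomP[i ->] ->].
  by rewrite rE -ex; apply/span_codomP; exists (C^~ i).
have rx : (r @: x)%VS = x.
  have kr := eqP (isometry_inj formL formC ef rS).
  by apply/eqP; rewrite eqEdim rx' limg_dim_eq ?leqnn // kr capv0.
have sg : siegel p by split.
have sr : siegel r by split.
have tE : eq_mod_squares (theta t) 1.
  apply: (thetat S) => i iS; rewrite smap_e // smap_f // /g /g' ?iS //.
  by rewrite (negPf iS).
have thE : eq_mod_squares (theta h) (\det C).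
  rewrite {1}hr; apply: eq_mod_squares_trans (thetaM _ _ _ sg tS sr) _.
  apply: eq_mod_squares_trans
    (eq_mod_squaresM (eq_mod_squaresM (thetad _ sg) tE) (thetad _ sr)) _.
  rewrite mulr1 -(det_on_comp ef ex) ?px //.
  rewrite (det_onE (C := C) EG Ex); first exact: eq_mod_squares_refl.
  move=> m; rewrite comp_lfunE rE linear_sum; apply: eq_bigr => j _.
  by rewrite linearZ /= smap_e.
split=> //; rewrite /rs_j.
(* [C] is invertible because [theta h] is nonzero and agrees with [\det C] up to a square. *)
have Cu : C \in unitmx.
  by rewrite unitmxE unitfE; apply: eq_mod_squares_neq0 thE (theta0 _ hS).
have hx : (h @: x)%VS = <<codom H>>%VS.
  apply/eqP; rewrite eqEsubv; apply/andP; split.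
    rewrite -{1}Ex limg_span; apply/span_subvP=> v /mapP[_ /codomP[i ->] ->].
    by rewrite hE; apply/span_codomP; exists (C^~ i).
  apply/span_subvP=> v /codomP[i ->].
  have -> : H i = h (\sum_m (invmx C) m i *: E m).
    rewrite linear_sum; under eq_bigr do rewrite linearZ /= hE scaler_sumr.
    rewrite exchange_big (bigD1 i) //= [X in _ + X]big1 ?addr0 => [|j ji].
      under eq_bigr do rewrite scalerA mulrC.
      rewrite -scaler_suml; have := mulmxV Cu => /matrixP/(_ i i).
      by rewrite !mxE eqxx => ->; rewrite scale1r.
    under eq_bigr do rewrite scalerA mulrC.
    rewrite -scaler_suml; have := mulmxV Cu => /matrixP/(_ j i).
    by rewrite !mxE (negPf ji) => ->; rewrite scale0r.
  by apply: memv_img; rewrite -Ex; apply/span_codomP; exists ((invmx C)^~ i).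
(* A vector of [h x] is a combination of the [H i]. Pairing it with [E i] for [i] in [S] reads off
   its coefficient on [G i], which is 0 if the vector lies in [x]. *)
have -> : (x :&: h @: x)%VS = <<map E (enum (~: S))>>%VS.
  rewrite hx; apply/eqP; rewrite eqEsubv; apply/andP; split.
    apply/subvP=> v; rewrite memv_cap -Ex => /andP[/(mem_lagr formL formC EG) vx].
    case/span_codomP=> c vE; rewrite vE; apply: memv_suml => i _.
    have [iS|iS] := boolP (i \in S); last first.
      rewrite /H (negPf iS); apply/memvZ/memv_span/map_f.
      by rewrite mem_enum inE.
    suff -> : c i = 0 by rewrite scale0r mem0v.
    have [_ HH _ _] := EG'; have := vx i; rewrite vE formC => /eqP.
    rewrite oppr_eq0 (sform_sumL formL) => /eqP.
    have HE j : form (H j) (E i) = - (j == i)%:R.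
      by have := HH j i; rewrite /H' iS (sformNr formL formC) => <-; rewrite opprK.
    under eq_bigr do rewrite HE mulrN.
    by rewrite sumrN sum_delta => /eqP; rewrite oppr_eq0 => /eqP.
  apply/span_subvP=> v hv; have [i iS ->] := mapP hv; rewrite mem_enum inE in iS.
  rewrite memv_cap -{1}Ex !memv_span ?codom_f //.
  by apply/codomP; exists i; rewrite /H (negPf iS).
rewrite (dim_span_dual (d := fun i v => form v (G i))) ?enum_uniq //.
- rewrite -cardE; have := cardsC S; rewrite card_ord => cE.
  apply/eqP; rewrite -(eqn_add2r #|~: S|) cE subnK //.
  by rewrite -[X in (_ <= X)%N]card_ord max_card.
- by move=> i j; have [_ -> _ _] := EG; rewrite eq_sym.
Qed.

End Theta.

(** * Valuations and traces *)

Section Valuations.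
Variables (F : fieldType) (v : F -> int).
Hypothesis vP : normalized_valuation v.

Lemma nvalM x y : x != 0 -> y != 0 -> v (x * y) = v x + v y.
Proof. by case: vP => + _ _; apply. Qed.

Lemma nval1 : v 1 = 0.
Proof.
have := nvalM (oner_neq0 F) (oner_neq0 F).
by rewrite mulr1 => /eqP; rewrite -subr_eq subrr eq_sym => /eqP.
Qed.

Lemma nvalN x : v (- x) = v x.
Proof.
have [->|x0] := eqVneq x 0; first by rewrite oppr0.
have n0 : (-1 : F) != 0 by rewrite oppr_eq0 oner_eq0.
have := nvalM n0 n0; rewrite mulrNN mulr1 nval1 => h.
by rewrite -mulN1r nvalM //; lia.
Qed.

Lemma nvalV x : x != 0 -> v x^-1 = - v x.
Proof.
move=> x0; have xV : x^-1 != 0 by rewrite invr_eq0.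
by have := nvalM x0 xV; rewrite divff // nval1; lia.
Qed.

Lemma nvalXz x (m : int) : x != 0 -> v (x ^ m) = m * v x.
Proof.
move=> x0.
have nvalX n : v (x ^+ n) = n%:Z * v x.
  elim: n => [|n IHn]; first by rewrite expr0 nval1 mul0r.
  by rewrite exprS nvalM ?expf_neq0 // IHn; lia.
case: m => n; first by rewrite -exprnP nvalX.
by rewrite NegzE -exprnN nvalV ?expf_neq0 // nvalX; lia.
Qed.

Lemma videalP m x : x != 0 -> videal v m x <-> m <= v x.
Proof. by move=> x0; split=> [[E|//]|]; [rewrite E eqxx in x0 | right]. Qed.

Lemma videal_le m n x : m <= n -> videal v n x -> videal v m x.
Proof. by move=> mn [->|h]; [left | right; apply: le_trans h]. Qed.

Lemma videalD m x y : videal v m x -> videal v m y -> videal v m (x + y).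
Proof.
have [->|x0] := eqVneq x 0; first by rewrite add0r.
have [->|y0] := eqVneq y 0; first by rewrite addr0.
have [->|xy0] := eqVneq (x + y) 0; first by left.
move=> /(videalP _ x0) hx /(videalP _ y0) hy; apply/videalP => //.
by case: vP => _ h _; apply: le_trans (h _ _ x0 y0 xy0); rewrite le_min hx hy.
Qed.

Lemma videalN m x : videal v m (- x) <-> videal v m x.
Proof.
rewrite /videal /= nvalN; split=> -[E|]; try by right.
  by left; rewrite -[x]opprK E oppr0.
by left; rewrite E oppr0.
Qed.

Lemma videalB m x y : videal v m x -> videal v m y -> videal v m (x - y).
Proof. by move=> hx hy; apply: videalD => //; apply/videalN. Qed.

Lemma videal_mulE c x m : c != 0 -> videal v (v c + m) (c * x) <-> videal v m x.
Proof.
move=> c0; have [->|x0] := eqVneq x 0.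
  by rewrite mulr0; split=> _; left.
by rewrite !videalP ?mulf_neq0 // nvalM // lerD2l.
Qed.

Lemma videal_mul_unit c x m : c != 0 -> v c = 0 ->
  videal v m (c * x) <-> videal v m x.
Proof. by move=> c0 vc; rewrite -(videal_mulE x m c0) vc add0r. Qed.

Lemma videalM m n x y : videal v m x -> videal v n y ->
  videal v (m + n) (x * y).
Proof.
have [->|x0] := eqVneq x 0; first by rewrite mul0r; left.
have [->|y0] := eqVneq y 0; first by rewrite mulr0; left.
by rewrite !videalP ?mulf_neq0 // nvalM // => *; apply: lerD.
Qed.

Lemma videal_shift c x : c != 0 ->
  videal v (v c) x <-> exists2 y, videal v 0 y & x = c * y.
Proof.
move=> c0; split=> [xc|[y y0 ->]].
  exists (c^-1 * x); last by rewrite mulVKf.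
  by apply/(videal_mulE _ _ c0); rewrite addr0 mulVKf.
by rewrite -[v c]addr0; apply/videal_mulE.
Qed.

End Valuations.

Section LocalFields.
Variables (k : fieldType) (Fq : finFieldType) (K : localField k Fq).
Local Notation v := (lf_val K).
Local Notation pi := (lf_unif K).
Let vP := lf_valP K.

Lemma lf_unif_neq0 : pi != 0. Proof. by case: (lf_unifP K). Qed.

Lemma lf_val_unif : v pi = 1. Proof. by case: (lf_unifP K). Qed.

Lemma lf_val_unifXz m : v (pi ^ m) = m.
Proof. by rewrite (nvalXz vP _ lf_unif_neq0) lf_val_unif mulr1. Qed.

Lemma redD x y : lf_int K x -> lf_int K y ->
  lf_red K (x + y) = lf_red K x + lf_red K y.
Proof. by move=> hx hy; apply: lf_redD; rewrite inE. Qed.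

Lemma redM x y : lf_int K x -> lf_int K y ->
  lf_red K (x * y) = lf_red K x * lf_red K y.
Proof. by move=> hx hy; apply: lf_redM; rewrite inE. Qed.

Lemma lf_int0 : lf_int K 0. Proof. by left. Qed.

Lemma lf_int1 : lf_int K 1.
Proof. by right; rewrite (nval1 vP). Qed.

Lemma lf_intM x y : lf_int K x -> lf_int K y -> lf_int K (x * y).
Proof. exact: (videalM vP (m := 0) (n := 0)). Qed.

Lemma red0 : lf_red K 0 = 0.
Proof.
have := redD lf_int0 lf_int0; rewrite addr0 => /eqP.
by rewrite -subr_eq subrr eq_sym => /eqP.
Qed.

Lemma redN x : lf_int K x -> lf_red K (- x) = - lf_red K x.
Proof.
move=> hx; apply/eqP; rewrite -addr_eq0 -redD ?addNr ?red0 //.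
exact/(videalN vP).
Qed.

Lemma lf_two_neq0 : (2 : k) != 0.
Proof.
apply/eqP=> E; have := lf_char0 K 2%N; by rewrite !inE /= E eqxx.
Qed.

Lemma Fq_two_neq0 : (2 : Fq) != 0.
Proof.
by apply/negP=> h; have := lf_odd K; rewrite inE /= h.
Qed.

(** The residual characteristic is odd, so [2] has nonzero reduction. Halving is thus harmless in
    every ideal. *)
Lemma lf_val2 : v 2 = 0.
Proof.
have i2 : lf_int K 2 by apply: (videalD vP); apply: lf_int1.
have r2 : lf_red K 2 != 0.
  by rewrite redD ?lf_red1; [exact: Fq_two_neq0 | exact: lf_int1..].
have h : ~ videal v 1 2 by move=> h; move/eqP: r2; apply; apply/lf_red_ker.
move: i2 h; rewrite /lf_int !(videalP _ _ lf_two_neq0); lia.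
Qed.

Lemma videal_half m x : videal v m (2^-1 * x) <-> videal v m x.
Proof.
by apply: (videal_mul_unit vP); rewrite ?invr_eq0 ?(nvalV vP) ?lf_val2
  ?lf_two_neq0.
Qed.

End LocalFields.

Section Traces.
Variables (F : fieldType) (L : fieldExtType F).

Lemma ext_trace_linear (a : F) (x y : L) :
  ext_trace (a *: x + y) = a * ext_trace x + ext_trace y.
Proof.
rewrite /ext_trace mulr_sumr -big_split; apply: eq_bigr => i _ /=.
by rewrite mulrDl linearD -scalerAl linearZ.
Qed.

Lemma ext_traceD (x y : L) : ext_trace (x + y) = ext_trace x + ext_trace y.
Proof. by have := ext_trace_linear 1 x y; rewrite scale1r mul1r. Qed.

Lemma ext_trace0 : ext_trace (0 : L) = 0.
Proof.
by have := ext_traceD 0 0; rewrite addr0 => /eqP; rewrite -subr_eq subrr eq_sym => /eqP.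
Qed.

Lemma ext_traceZ (a : F) (x : L) : ext_trace (a *: x) = a * ext_trace x.
Proof. by rewrite -[a *: x]addr0 ext_trace_linear ext_trace0 addr0. Qed.

End Traces.

Section TraceTower.
Variables (F : fieldType) (L : fieldExtType F).
Variables (E : {subfield L}) (tau : {rmorphism L -> L}) (u : L).
Hypothesis tauE : forall x, x \in E <-> tau x = x.
Hypothesis tauK : involutive tau.
Hypothesis two_neq0 : (2 : L) != 0.
Hypotheses (u0 : u != 0) (tauu : tau u = - u).
Hypothesis dimL : (\dim {:L} = 2 * \dim E)%N.

(** Transitivity of the trace, computed in the basis made of [b] and [b u]. If [x = a + c u] with
    [a] and [c] in [E], multiplication by [x] has two diagonal blocks, both equal to multiplication
    by [a], while [x + tau x = 2 a]. *)
Lemma ext_trace_tower (x : L) :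
  ext_trace x = ext_trace (vsproj E (x + tau x)).
Proof.
pose d : nat := \dim {:subvs_of E}; pose b := vbasis {:subvs_of E}.
have dE : d = \dim E by rewrite /d dimvf.
pose X := [tuple of map vsval b ++ map (fun y => vsval y * u) b] : (d + d)%N.-tuple L.
(* The halves of [y + tau y] and [y - tau y]; the second becomes fixed by [tau] after division by
   [u]. *)
have decE (y : L) : exists a c : subvs_of E, y = vsval a + vsval c * u.
  have t2 : tau 2 = 2 by rewrite rmorph_nat.
  exists (vsproj E ((y + tau y) / 2)), (vsproj E ((y - tau y) / (2 * u))).
  rewrite !vsprojK; first by field; rewrite u0.
    apply/tauE; rewrite rmorphM fmorphV rmorphM rmorphB tauK t2 tauu; field.
    by rewrite oppr_eq0 u0 two_neq0.
  by apply/tauE; rewrite rmorphM fmorphV rmorphD tauK t2 addrC.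
have bE (a : subvs_of E) : a = \sum_j coord b j a *: b`_j.
  by apply: coord_basis (memvf a); apply: vbasisP.
have Xl (i : 'I_d) : X`_(lshift d i) = vsval b`_i.
  rewrite /= nth_cat size_map size_tuple ltn_ord (nth_map 0) //.
  by rewrite size_tuple.
have Xr (i : 'I_d) : X`_(rshift d i) = vsval b`_i * u.
  rewrite /= nth_cat size_map size_tuple ltnNge leq_addr /= addKn (nth_map 0) //.
  by rewrite size_tuple.
have mat (a : subvs_of E) : {M : 'M_d |
    forall i : 'I_d, a * b`_i = \sum_j M j i *: b`_j & M = \matrix_(j, i) coord b j (a * b`_i)}.
  exists (\matrix_(j, i) coord b j (a * b`_i)) => // i.
  by rewrite {1}(bE (a * _)); apply: eq_bigr => j _; rewrite mxE.
have [a [c xE]] := decE x.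
have u2 : u * u \in E by apply/tauE; rewrite rmorphM tauu mulrNN.
have [Ma MaE Ma'] := mat a; have [Mc McE _] := mat c.
have [Mu MuE _] := mat (c * vsproj E (u * u)).
have trA : \tr Ma = ext_trace a.
  by rewrite Ma'; apply: eq_bigr => i _; rewrite mxE.
have vs_sum (M : 'M_d) i : vsval (\sum_j M j i *: b`_j) = \sum_j M j i *: vsval b`_j.
  by rewrite linear_sum; apply: eq_bigr => j _; rewrite linearZ.
have bX : basis_of {:L} X.
  rewrite basisEdim size_tuple dimL mul2n -addnn -dE leqnn andbT.
  apply/subvP=> y _; have [a' [c' ->]] := decE y; apply: memvD.
    rewrite (bE a') linear_sum; apply: memv_suml => j _; rewrite linearZ.
    by apply/memvZ/memv_span; rewrite /= -Xl mem_nth // size_tuple.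
  rewrite (bE c') linear_sum mulr_suml; apply: memv_suml => j _.
  rewrite linearZ -scalerAl.
  by apply/memvZ/memv_span; rewrite /= -Xr mem_nth // size_tuple.
have -> : ext_trace x = \tr (block_mx Ma Mu Mc Ma).
  have mulxE : linfun ( *%R x) =1 *%R x.
    by apply: linfunE => c' y z; rewrite mulrDr scalerAr.
  have pX (i : 'I_(d + d)) : linfun ( *%R x) X`_i =
      \sum_j block_mx Ma Mu Mc Ma j i *: X`_j.
    rewrite mulxE big_split_ord /=; case: (split_ordP i) => j ->.
      rewrite -/d Xl; under eq_bigr do rewrite Xl block_mxEul.
      under [X in _ + X]eq_bigr do rewrite Xr block_mxEdl scalerAl.
      rewrite -mulr_suml -!vs_sum -MaE -McE xE !rmorphM /=; ring.
    rewrite -/d Xr; under eq_bigr do rewrite Xl block_mxEur.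
    under [X in _ + X]eq_bigr do rewrite Xr block_mxEdr scalerAl.
    rewrite -mulr_suml -!vs_sum -MaE -MuE xE !rmorphM /= vsprojK //; ring.
  rewrite -(trace_vbasis bX pX).
  by apply: eq_bigr => i _; rewrite mulxE.
rewrite mxtrace_block trA.
have -> : vsproj E (x + tau x) = a + a.
  apply: val_inj; rewrite /= vsprojK; last first.
    by apply/tauE; rewrite rmorphD tauK addrC.
  rewrite xE rmorphD rmorphM tauu.
  have fixE (y : subvs_of E) : tau (vsval y) = vsval y by apply/tauE/subvsP.
  by rewrite !fixE; ring.
by rewrite ext_traceD.
Qed.

End TraceTower.

(** * Arithmetic of irreducible tori *)

Definition additive_subgroup (V : zmodType) (L : set V) : Prop :=
  L 0 /\ forall x y, L x -> L y -> L (x - y).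

Section AdditiveSubgroups.
Variables (V : zmodType) (L : set V).
Hypothesis LP : additive_subgroup L.

Lemma asg0 : L 0. Proof. by case: LP. Qed.

Lemma asgB x y : L x -> L y -> L (x - y).
Proof. by case: LP => _; apply. Qed.

Lemma asgN x : L x -> L (- x).
Proof. by move=> Lx; rewrite -sub0r; apply: asgB => //; exact: asg0. Qed.

Lemma asgD x y : L x -> L y -> L (x + y).
Proof. by move=> Lx Ly; rewrite -[y]opprK; apply/asgB/asgN. Qed.

End AdditiveSubgroups.

Section TorusArithmetic.
Variables (k : fieldType) (Fq : finFieldType) (K : localField k Fq).
Variables (lam : int) (W : vectType k) (beta : W -> W -> k).
Variables (T : set 'End(W)) (D : irreducibleTorus K beta T).
Local Notation L := (it_k2 D).
Local Notation k1 := (it_k1 D).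
Local Notation tau := (it_tau D).
Local Notation v1 := (it_v1 D).
Local Notation v2 := (it_v2 D).
Local Notation e2 := (it_e2 D)%:Z.
Local Notation iso := (it_iso D).
Local Notation u := (it_u D).
Local Notation pi1 := (vsval (it_unif1 D)).
Local Notation vK := (lf_val K).
Local Notation mu := (it_mu lam D).
(** [N] is the exponent of the ideal of k' dual to O' for the trace with values modulo [varpi^lam];
    [M] is the exponent of B_i in k''. *)
Local Notation N := ((it_e D)%:Z * lam - it_delta D).
Local Notation M :=
  (if it_ramified D then mu else ((mu + 1) %/ 2)%Z).
Let v1P := it_v1P D.
Let v2P := it_v2P D.

Lemma it_e2_gt0 : 0 < e2. Proof. by case: (it_e2P D). Qed.

Lemma v2_vsval (x : subvs_of k1) : x != 0 -> v2 (vsval x) = e2 * v1 x.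
Proof. by case: (it_e2P D) => _; apply. Qed.

Lemma vsval_neq0 (x : subvs_of k1) : (vsval x != 0) = (x != 0).
Proof. by congr negb; apply/eqP/eqP=> [E|->] //; apply: val_inj. Qed.

Lemma videal_vsval m (x : subvs_of k1) :
  videal v2 (e2 * m) (vsval x) <-> videal v1 m x.
Proof.
have [->|x0] := eqVneq x 0; first by rewrite linear0; split=> _; left.
rewrite !videalP ?vsval_neq0 // v2_vsval // ler_pM2l //; exact: it_e2_gt0.
Qed.

Lemma tau_u : tau u = - u.
Proof. by case: (it_uP D) => _ /eqP; rewrite addrC addr_eq0 => /eqP. Qed.

Lemma u_neq0 : u != 0. Proof. by case: (it_uP D). Qed.

Lemma L_twoE : (2 : L) = vsval ((2 : k)%:A : subvs_of k1).
Proof. by rewrite linearZ /= algid1 scaler_nat. Qed.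

Lemma L_two_neq0 : (2 : L) != 0.
Proof.
rewrite L_twoE vsval_neq0 scaler_eq0 (negPf (lf_two_neq0 K)).
exact: oner_neq0.
Qed.

Lemma v1_scalar c : c != 0 -> v1 (c%:A) = (it_e D)%:Z * vK c.
Proof. by case: (it_eP D) => _; apply. Qed.

Lemma v2_two : v2 2 = 0.
Proof.
have := L_two_neq0; rewrite L_twoE vsval_neq0 => h.
by rewrite v2_vsval // v1_scalar ?(lf_two_neq0 K) // lf_val2 !mulr0.
Qed.

Lemma videal_two m x : videal v2 m (2 * x) <-> videal v2 m x.
Proof. by apply: (videal_mul_unit v2P); rewrite ?v2_two ?L_two_neq0. Qed.

Lemma tau_neq0 x : (tau x != 0) = (x != 0).
Proof. by rewrite fmorph_eq0. Qed.

Lemma videal_tau m x : videal v2 m (tau x) <-> videal v2 m x.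
Proof.
rewrite /videal /= it_v2_tau; split=> -[E|]; try by right.
  by left; apply/eqP; rewrite -(fmorph_eq0 tau) E.
by left; rewrite E rmorph0.
Qed.

(** Multiplication by [varpi^(-lam)], of valuation [- e * lam] in k', brings the target ideal back
    to O, where the condition defines the inverse different. *)
Lemma ext_trace_ideal (s : subvs_of k1) :
  (forall y, videal v1 0 y -> videal vK lam (ext_trace (s * y))) <->
  videal v1 N s.
Proof.
pose c := lf_unif K ^ (- lam).
have c0 : c != 0 by rewrite expfz_neq0 // lf_unif_neq0.
have vc : vK c = - lam by rewrite lf_val_unifXz.
have cA0 : (c%:A : subvs_of k1) != 0 by rewrite scaler_eq0 (negPf c0) oner_neq0.
have vcA : v1 (c%:A) = - ((it_e D)%:Z * lam) by rewrite v1_scalar // vc mulrN.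
have dP := it_deltaP (i := D) (c%:A * s).
have sP : videal v1 (- it_delta D) (c%:A * s) <-> videal v1 N s.
  rewrite -(videal_mulE v1P s N cA0) vcA (_ : - _ + N = - it_delta D) //.
  by lia.
have h y : lf_int K (ext_trace (c%:A * s * y)) <->
    videal vK lam (ext_trace (s * y)).
  rewrite -mulrA mulr_algl ext_traceZ /lf_int (_ : 0 = vK c + lam).
    exact: (videal_mulE (lf_valP K)).
  by rewrite vc addNr.
split=> [H|/sP/dP H y hy]; last by apply/h/H.
by apply/sP/dP => y hy; apply/h/H.
Qed.

Lemma trace_fixed x : x + tau x \in k1.
Proof. by apply/it_tau_fix; rewrite rmorphD it_tauK addrC. Qed.

(** The integers of k'' are stable under those of k', so [y] may be replaced by [y y'] with [y'] in
    O'. The relative trace of [z y] then pairs with all of O' and the previous criterion applies to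
    it. *)
Lemma ext_trace_dual z :
  (forall y, videal v2 0 y -> videal vK lam (ext_trace (z * y))) <->
  (forall y, videal v2 0 y -> videal v2 (e2 * N) (z * y + tau (z * y))).
Proof.
have tower x := ext_trace_tower (it_tau_fix (i := D)) (@it_tauK _ _ _ _ _ _ D) L_two_neq0
  u_neq0 tau_u (it_dim2 D) x.
split=> H y hy.
  rewrite -(vsprojK (trace_fixed (z * y))); apply/videal_vsval.
  apply/ext_trace_ideal => y' hy'.
  have -> : vsproj k1 (z * y + tau (z * y)) * y' =
      vsproj k1 (z * (y * vsval y') + tau (z * (y * vsval y'))).
    apply: val_inj; rewrite /= !vsprojK ?trace_fixed //.
    have ty : tau (vsval y') = vsval y' by apply/it_tau_fix/subvsP.
    by rewrite mulrA [tau (z * y * _)]rmorphM ty mulrDl.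
  rewrite -tower; apply: H; rewrite -[0]addr0; apply: (videalM v2P) => //.
  by rewrite -[0](mulr0 e2); apply/videal_vsval.
rewrite tower -[vsproj _ _]mulr1.
have /ext_trace_ideal : videal v1 N (vsproj k1 (z * y + tau (z * y))).
  by apply/videal_vsval; rewrite vsprojK ?trace_fixed //; apply: H.
by apply; right; rewrite (nval1 v1P).
Qed.

Lemma unif1_neq0 : pi1 != 0.
Proof. by rewrite vsval_neq0; case: (it_unif1P D). Qed.

Lemma tau_unif1Xz m : tau (pi1 ^ m) = pi1 ^ m.
Proof. by rewrite rmorphXz ?unitfE ?unif1_neq0 //; congr (_ ^ _); apply/it_tau_fix/subvsP. Qed.

Lemma v2_unif1 : v2 pi1 = e2.
Proof. by have [p0 p1] := it_unif1P D; rewrite v2_vsval // p1 mulr1. Qed.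

Lemma it_BP w : it_B lam D w <-> videal v2 M (iso w).
Proof.
have [p0 p1] := it_unif2P D.
rewrite /it_B /=; case: ifPn => r.
  have c0 : it_unif2 D ^ mu != 0 by rewrite expfz_neq0.
  have := videal_shift v2P (iso w) c0.
  by rewrite (nvalXz v2P) // p1 mulr1 => S; apply: iff_sym.
move: r; rewrite /it_ramified negbK => /eqP e1.
have c0 : pi1 ^ ((mu + 1) %/ 2)%Z != 0 by rewrite expfz_neq0 // unif1_neq0.
have := videal_shift v2P (iso w) c0.
by rewrite (nvalXz v2P) ?unif1_neq0 // v2_unif1 e1 mulr1 => S; apply: iff_sym.
Qed.

Lemma ramified_e2 : it_ramified D -> e2 = 2 /\ v2 u = 1.
Proof.
rewrite /it_ramified => r; have := it_unif D; have := it_u_val D.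
rewrite (negPf r) => -> E; have [p0 p1] := it_unif2P D; split=> //.
by rewrite -v2_unif1 -E expr2 (nvalM v2P) // p1.
Qed.

Lemma it_nu_neq0 : it_nu D != 0.
Proof. by rewrite mulf_neq0 ?u_neq0 // expfz_neq0 // unif1_neq0. Qed.

Lemma tau_nu : tau (it_nu D) = - it_nu D.
Proof. by rewrite rmorphM tau_u tau_unif1Xz mulNr. Qed.

Lemma v2_nu : ~~ it_ramified D -> v2 (it_nu D) = 0.
Proof.
rewrite negbK => /eqP e1.
rewrite (nvalM v2P) ?u_neq0 ?expfz_neq0 ?unif1_neq0 //.
by rewrite (nvalXz v2P) ?unif1_neq0 // v2_unif1 e1 mulr1 subrr.
Qed.

(** Two tests suffice: [y = 1] bounds [z + tau z], and the unit [y = nu] of trace 0 bounds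
    [z - tau z]. Their sum is [2 z], and [2] is a unit. *)
Lemma trace_ideal_unramified z : ~~ it_ramified D ->
  (forall y, videal v2 0 y -> videal v2 (e2 * N) (z * y + tau (z * y))) <->
  videal v2 N z.
Proof.
move=> r; have nu0 := it_nu_neq0; have vnu := v2_nu r.
have e1 : e2 = 1 by move: r; rewrite negbK => /eqP->.
rewrite e1 mul1r; split=> [H|hz y hy]; last first.
  apply: (videalD v2P); rewrite ?videal_tau -[N]addr0;
  exact: (videalM v2P).
apply/videal_two; have -> : 2 * z = (z + tau z) + (z - tau z) by ring.
apply: (videalD v2P).
  by have := H 1; rewrite mulr1; apply; right; rewrite (nval1 v2P).
apply/(videal_mul_unit v2P (c := it_nu D)) => //.
have := H (it_nu D); rewrite rmorphM tau_nu.
rewrite (_ : z * it_nu D + tau z * - it_nu D = it_nu D * (z - tau z)); last by ring.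
by apply; right; rewrite vnu.
Qed.

(* A trace lies in k1, so its valuation is even: the exponent [2 * N - 1]
   bounds it by [2 * N]. *)
Lemma trace_ideal_ramified z : it_ramified D ->
  (forall y, videal v2 0 y -> videal v2 (e2 * N) (z * y + tau (z * y))) <->
  videal v2 (2 * N - 1) z.
Proof.
move=> r; have [e2E vu] := ramified_e2 r.
have u0 := u_neq0; split=> [H|hz y hy]; last first.
  have : videal v2 (2 * N - 1) (z * y + tau (z * y)).
    apply: (videalD v2P); rewrite ?videal_tau -[2 * N - 1]addr0;
    exact: (videalM v2P).
  rewrite -(vsprojK (trace_fixed (z * y))).
  set s := vsproj _ _; have [->|s0] := eqVneq s 0; first by rewrite linear0; left.
  rewrite !videalP ?vsval_neq0 // v2_vsval // e2E; lia.
apply/videal_two; have -> : 2 * z = (z + tau z) + (z - tau z) by ring.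
apply: (videalD v2P).
  apply: (videal_le (n := e2 * N)); first by rewrite e2E; lia.
  by have := H 1; rewrite mulr1; apply; right; rewrite (nval1 v2P).
(* The test [y = u] has valuation 1, which costs one power: [u (z - tau z)] at level [2 * N] gives
   [z - tau z] at level [2 * N - 1]. *)
apply/(videal_mulE v2P _ _ u0); rewrite vu.
have := H u; rewrite rmorphM tau_u e2E.
rewrite (_ : z * u + tau z * - u = u * (z - tau z)); last by ring.
by rewrite (_ : 1 + (2 * N - 1) = 2 * N); [apply; right; rewrite vu | lia].
Qed.

(** Writing elements of B_i as [c y] with [v2 c = M] turns duality into a trace condition on
    [z = u tau(w) c]. In the ramified case it reads [v2 w >= 2 * N - 1 - v2 u - M], which is [mu]
    since [N = mu + 1] and [M = mu]. *)
Lemma it_dualP w : dual_lattice K lam beta (it_B lam D) w <->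
  videal v2 (if it_ramified D then mu else mu - M) (iso w).
Proof.
have [iso' isoK isoK'] := it_isoP D.
have [c c0 vc] : exists2 c : L, c != 0 & v2 c = M.
  have [p0 p1] := it_unif2P D; exists (it_unif2 D ^ M); first by rewrite expfz_neq0.
  by rewrite (nvalXz v2P) // p1 mulr1.
set z := u * tau (iso w) * c.
have -> : dual_lattice K lam beta (it_B lam D) w <->
    (forall y, videal v2 0 y -> videal vK lam (ext_trace (z * y))).
  split=> H => [y hy|b /it_BP].
    have := H (iso' (c * y)); rewrite it_BP isoK' -vc videal_shift // (@it_formE _ _ _ _ _ _ D).
    by rewrite isoK' mulrA videal_half; apply; exists y.
  rewrite -vc videal_shift // => -[y hy bE].
  by rewrite (@it_formE _ _ _ _ _ _ D) bE mulrA; apply/videal_half/H.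
rewrite ext_trace_dual.
have [w0|w0] := eqVneq (iso w) 0.
  rewrite w0; split=> _; first by left.
  by move=> y hy; left; rewrite /z w0 rmorph0 mulr0 !mul0r rmorph0 addr0.
have z0 : z != 0 by rewrite !mulf_neq0 ?u_neq0 ?tau_neq0.
have vz : v2 z = v2 u + v2 (iso w) + M.
  by rewrite !(nvalM v2P) ?mulf_neq0 ?u_neq0 ?tau_neq0 // it_v2_tau vc.
have [r|r] := boolP (it_ramified D).
  rewrite trace_ideal_ramified // !videalP // vz r.
  by have [_ ->] := ramified_e2 r; rewrite /it_mu; have [_ ->] := ramified_e2 r; lia.
rewrite trace_ideal_unramified // !videalP // vz (negPf r) /it_mu; lia.
Qed.

(** If [k''/k'] is ramified, or if [mu] is even, B_i and its dual have the same exponent. In the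
    remaining case the dual has exponent [mu - M = M - 1]. *)
Lemma not_self_dual : ~ self_dual K lam beta (it_B lam D) ->
  ~~ it_ramified D /\ mu = 2 * M - 1.
Proof.
move=> nsd.
have key : M = (if it_ramified D then mu else mu - M) -> False.
  move=> E; apply: nsd; apply/seteqP; split=> w; rewrite it_dualP it_BP -E //.
have [r|r] := boolP (it_ramified D); first by case: key; rewrite r.
split=> //; rewrite (negPf r) in key *.
have [q [qE|qE]] : exists q, mu = 2 * q \/ mu = 2 * q - 1.
  exists ((mu + 1) %/ 2)%Z; lia.
  by case: key; rewrite qE; lia.
by rewrite qE; lia.
Qed.

(** Replaces the coordinates on [1] and [nu] by a bound on [iso w] and a sharper one on its
    anti-invariant part, the exponent [(mu - 1) / 2] being [M - 1]. In this form the effect of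
    multiplication by an element of norm one is easy to estimate. *)
Lemma it_AP w : ~ self_dual K lam beta (it_B lam D) ->
  it_A lam D w <-> videal v2 (M - 1) (iso w)
                   /\ videal v2 M (iso w - tau (iso w)).
Proof.
move=> nsd; have [r muE] := not_self_dual nsd.
have e1 : e2 = 1 by move: r; rewrite negbK => /eqP->.
have nu0 := it_nu_neq0; have vnu := v2_nu r; have p0 := unif1_neq0.
have vp : v2 pi1 = 1 by rewrite v2_unif1 e1.
have videal1 m (y : subvs_of k1) : videal v2 m (vsval y) <-> videal v1 m y.
  by rewrite -videal_vsval e1 mul1r.
have fixE (y : subvs_of k1) : tau (vsval y) = vsval y by apply/it_tau_fix/subvsP.
set m := ((mu - 1) %/ 2)%Z; have mE : M - 1 = m.
  by rewrite /m; move: muE; rewrite (negPf r); lia.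
have ME : M = m + 1 by rewrite -mE; lia.
rewrite mE ME; pose q := pi1 ^ m.
have q0 : q != 0 by rewrite expfz_neq0.
have vq : v2 q = m by rewrite (nvalXz v2P) // vp mulr1.
have tq : tau q = q by apply: tau_unif1Xz.
split.
  case=> [[sd _]|[_ [y [z [hy hz ->]]]]]; first by case: nsd.
  rewrite -/q; set s := vsval y + _.
  have ts : tau s = vsval y - vsval z * pi1 * it_nu D.
    by rewrite rmorphD 2!rmorphM !fixE tau_nu mulrN.
  rewrite rmorphM tq -{1}[m]addr0 -vq; split.
    apply/(videal_mulE v2P) => //; apply: (videalD v2P); first exact/videal1.
    rewrite mulrAC mulrC; apply: (videal_le (n := 1 + 0)) => //.
    rewrite -{1}vp; apply/(videal_mulE v2P) => //.
    rewrite mulrC; apply/(videal_mul_unit v2P) => //; exact/videal1.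
  rewrite -mulrBr; apply/(videal_mulE v2P) => //.
  have -> : s - tau s = pi1 * (it_nu D * (2 * vsval z)) by rewrite ts /s; ring.
  rewrite -[1]addr0 -{1}vp; apply/(videal_mulE v2P) => //.
  by apply/(videal_mul_unit v2P) => //; apply/videal_two/videal1.
move=> [h1 h2]; right; split=> //.
have t2 : tau 2 = 2 by rewrite rmorph_nat.
have two0 := L_two_neq0.
set i := iso w in h1 h2 *.
(* Invariant and anti-invariant halves of [i], normalized so that [i = q (y + z pi1 nu)]. *)
pose y := q^-1 * ((i + tau i) / 2).
pose z := (q * pi1)^-1 * ((i - tau i) / (2 * it_nu D)).
have tp : tau pi1 = pi1 by apply: fixE.
have yk : y \in k1.
  apply/it_tau_fix.
  by rewrite rmorphM fmorphV rmorphM fmorphV rmorphD it_tauK t2 tq [tau i + i]addrC.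
have zk : z \in k1.
  apply/it_tau_fix; rewrite rmorphM fmorphV !rmorphM fmorphV rmorphM.
  rewrite rmorphB it_tauK t2 tq tp tau_nu /z; field.
  by rewrite ?oppr_eq0 nu0 p0 q0 two0.
exists (vsproj k1 y), (vsproj k1 z); split.
- apply/videal1; rewrite vsprojK // -(videal_mulE v2P _ _ q0) vq addr0.
  rewrite /y mulrA divff // mul1r mulrC; apply/videal_two.
  rewrite mulrA divff // mul1r; apply: (videalD v2P) => //.
  exact/videal_tau.
- have qp0 : q * pi1 != 0 by rewrite mulf_neq0.
  apply/videal1; rewrite vsprojK // -(videal_mulE v2P _ _ qp0).
  rewrite (nvalM v2P) // vq vp addr0 /z mulrA divff // mul1r.
  apply/videal_two/(videal_mul_unit v2P (c := it_nu D)) => //.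
  by rewrite (_ : it_nu D * _ = i - tau i) //; field; rewrite ?nu0 ?two0.
- rewrite !vsprojK // -/q /y /z; field.
  by rewrite ?nu0 ?p0 ?q0 ?two0.
Qed.

Lemma torus_scalar g : T g ->
  exists t, [/\ t != 0, v2 t = 0 & forall w, iso (g w) = t * iso w].
Proof.
move=> /(@it_torusE _ _ _ _ _ _ D)[] t tt tE; exists t; have t0 : t != 0.
  by apply/eqP=> E; move/eqP: tt; rewrite E mul0r eq_sym oner_eq0.
split=> //; have := nvalM v2P t0; rewrite -(tau_neq0) in t0.
by move=> /(_ _ t0); rewrite tt (nval1 v2P) it_v2_tau; lia.
Qed.

Lemma it_B_subgroup : additive_subgroup (it_B lam D).
Proof.
split=> [|x y]; rewrite !it_BP; first by rewrite linear0; left.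
by rewrite linearB; apply: (videalB v2P).
Qed.

Lemma it_A_subgroup : additive_subgroup (it_A lam D).
Proof.
have [sd|nsd] := pselect (self_dual K lam beta (it_B lam D)).
  have AE w : it_A lam D w <-> it_B lam D w.
    by split=> [[[]|[]]|] //; left.
  have [B0 BB] := it_B_subgroup.
  by split=> [|x y]; rewrite !AE //; apply: BB.
split=> [|x y]; rewrite !it_AP //.
  by rewrite linear0 rmorph0 subr0; split; left.
move=> [x1 x2] [y1 y2]; rewrite !linearB /=; split; first exact: (videalB v2P).
rewrite rmorphB (_ : _ - _ - _ = (iso x - tau (iso x)) - (iso y - tau (iso y))).
  exact: (videalB v2P).
by ring.
Qed.

Lemma it_B_sub_A : it_B lam D `<=` it_A lam D.
Proof.
move=> w Bw; have [sd|nsd] := pselect (self_dual K lam beta (it_B lam D)).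
  by left.
apply/it_AP => //; move/it_BP: Bw => h; split.
  by apply: videal_le h; lia.
by apply: (videalB v2P) => //; apply/videal_tau.
Qed.

Lemma it_A_sub_dual : it_A lam D `<=` dual_lattice K lam beta (it_B lam D).
Proof.
move=> w; have [sd|nsd] := pselect (self_dual K lam beta (it_B lam D)).
  by case=> [[_]|[]//]; rewrite {1}sd.
case/it_AP => // h _; apply/it_dualP.
have [r E] := not_self_dual nsd; move: h; rewrite (negPf r) in E *.
by apply: videal_le; lia.
Qed.

Lemma torus_stable_B g w : T g -> it_B lam D w -> it_B lam D (g w).
Proof.
move=> /torus_scalar[t [t0 vt tE]]; rewrite !it_BP tE.
by move=> h; apply/(videal_mul_unit v2P).
Qed.

(* The identity [t s - tau (t s) = (t - tau t) s + tau t (s - tau s)] decides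
   between the two cases according to the valuation of [t - tau t]. *)
Lemma torus_dichotomy g : T g ->
  (forall w, it_A lam D w -> it_A lam D (g w)) \/
  (forall w, it_A lam D w -> it_A lam D (g w) -> it_B lam D w).
Proof.
move=> Tg; have [sd|nsd] := pselect (self_dual K lam beta (it_B lam D)).
  by right=> w [[]|[]].
have [t [t0 vt tE]] := torus_scalar Tg.
have t0' : tau t != 0 by rewrite tau_neq0.
have vt' : v2 (tau t) = 0 by rewrite it_v2_tau.
have id w : t * iso w - tau (t * iso w) =
    (t - tau t) * iso w + tau t * (iso w - tau (iso w)).
  by rewrite rmorphM; ring.
have i0 : videal v2 0 t by right; rewrite vt.
have [h|h] := pselect (videal v2 1 (t - tau t)); [left|right] => w;
    rewrite ?it_BP !it_AP // => -[w1 w2].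
  rewrite tE; split; first exact/(videal_mul_unit v2P).
  rewrite id; apply: (videalD v2P); last exact/(videal_mul_unit v2P).
  by rewrite (_ : M = 1 + (M - 1)); [exact: (videalM v2P) | lia].
rewrite tE id => -[_ h2].
have d0 : t - tau t != 0 by apply/eqP=> E; apply: h; left.
have vd : v2 (t - tau t) = 0.
  have : videal v2 0 (t - tau t) by apply: (videalB v2P) => //; apply/videal_tau.
  by move: h; rewrite !videalP //; lia.
apply/(videal_mul_unit v2P _ _ d0 vd).
have -> : (t - tau t) * iso w = ((t - tau t) * iso w
    + tau t * (iso w - tau (iso w))) - tau t * (iso w - tau (iso w)) by ring.
by apply: (videalB v2P) => //; apply/(videal_mul_unit v2P).
Qed.

End TorusArithmetic.

(** * Residual symplectic spaces *)

Section SymplecticForms.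
Variables (k : fieldType) (W : vectType k) (beta : W -> W -> k).
Hypothesis betaP : symplectic_form beta.

Lemma symp_linearl a x y z : beta (a *: x + y) z = a * beta x z + beta y z.
Proof. by case: betaP. Qed.

Lemma symp_skew x y : beta x y = - beta y x.
Proof.
have [bl br bx _] := betaP.
have bD u v w : beta (u + v) w = beta u w + beta v w.
  by rewrite -[u]scale1r bl mul1r scale1r.
have bD' u v w : beta w (u + v) = beta w u + beta w v.
  by rewrite -[u]scale1r br mul1r scale1r.
by apply/eqP; rewrite -addr_eq0; have := bx (x + y);
  rewrite bD !bD' !bx add0r addr0 => ->.
Qed.

Lemma symp_Sp_inj g : Sp beta g -> lker g == 0%VS.
Proof.
have [bl br bx nd] := betaP => gS; apply/lker0P=> x y E.
apply/eqP; rewrite -subr_eq0; apply/eqP/nd => z.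
rewrite -(gS (x - y)) linearB /= E subrr.
by rewrite (sform0l symp_linearl).
Qed.

Lemma Sp_inv g x y : Sp beta g -> beta (g x) y = beta x ((g^-1)%VF y).
Proof.
move=> gS; have g0 := symp_Sp_inj gS.
by rewrite -{1}(lker0_lfunVK g0 y) gS.
Qed.

End SymplecticForms.

Section ResidualSpaces.
Variables (k : fieldType) (Fq : finFieldType) (K : localField k Fq) (lam : int).
Local Notation vK := (lf_val K).
Let vP := lf_valP K.

Section One.
Variables (W : vectType k) (beta : W -> W -> k) (A B : set W).
Hypothesis betaP : symplectic_form beta.
Variable Q : residualSpace K lam beta A B.
Local Notation dual := (dual_lattice K lam beta B).
Local Notation pr := (rs_pr Q).
Local Notation form := (@rs_form _ _ _ _ _ _ _ _ Q).
Let bl := symp_linearl betaP.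
Let bC := symp_skew betaP.

Lemma dual_scale_add c x y : lf_int K c -> dual x -> dual y -> dual (c *: x + y).
Proof.
move=> hc hx hy w Bw; rewrite bl; apply: (videalD vP); last exact: hy.
by rewrite -[lam]add0r; apply: (videalM vP) => //; apply: hx.
Qed.

Lemma dual0 : dual 0.
Proof. by move=> w _; rewrite (sform0l bl); left. Qed.

Lemma dualZ c x : lf_int K c -> dual x -> dual (c *: x).
Proof.
by move=> hc hx; rewrite -[_ *: _]addr0; apply: dual_scale_add => //; exact: dual0.
Qed.

Lemma dualD x y : dual x -> dual y -> dual (x + y).
Proof.
by move=> hx; rewrite -[x in x + _]scale1r; apply: dual_scale_add => //; exact: lf_int1.
Qed.

Lemma dualN x : dual x -> dual (- x).
Proof.
move=> hx; rewrite -scaleN1r; apply: dualZ => //.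
by apply/(videalN vP); exact: lf_int1.
Qed.

Lemma dual_subgroup : additive_subgroup dual.
Proof. by split=> [|x y hx hy]; [exact: dual0 | apply/dualD/dualN]. Qed.

Lemma prD x y : dual x -> dual y -> pr (x + y) = pr x + pr y.
Proof. by move=> hx hy; apply: rs_prD; rewrite inE. Qed.

Lemma pr0 : pr 0 = 0.
Proof.
have := prD dual0 dual0; rewrite addr0 => /eqP.
by rewrite -subr_eq subrr eq_sym => /eqP.
Qed.

Lemma prN x : dual x -> pr (- x) = - pr x.
Proof.
move=> hx; apply/eqP; rewrite -addr_eq0 -prD ?addNr ?pr0 //; exact: dualN.
Qed.

Lemma pr_eq x y : dual x -> dual y -> pr x = pr y <-> B (x - y).
Proof.
move=> hx hy; rewrite -(rs_pr_ker Q (dual_subgroup.2 _ _ hx hy)).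
rewrite prD ?prN //; last exact: dualN.
by split=> [->|/eqP]; rewrite ?subrr // subr_eq0 => /eqP.
Qed.

(** The inclusion [varpi B^* <= B] is read off the residual space: [varpi] reduces to 0, so
    [varpi x] is in the kernel [B] of the projection and can be paired with [y]. *)
Lemma dual_form_int x y : dual x -> dual y ->
  lf_int K (lf_unif K ^ (1 - lam) * beta x y).
Proof.
move=> hx hy; have pi0 := lf_unif_neq0 K.
have Bpx : B (lf_unif K *: x).
  have ip : lf_int K (lf_unif K) by right; rewrite lf_val_unif.
  apply/(rs_pr_ker Q); first exact: dualZ.
  rewrite rs_prZ //; have /(lf_red_ker ip)-> : videal vK 1 (lf_unif K).
    by right; rewrite lf_val_unif.
  by rewrite scale0r.
have : videal vK lam (lf_unif K * beta x y).
  have := hy _ Bpx; rewrite bC; move/(videalN vP); rewrite -[_ *: x]addr0 bl.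
  by rewrite (sform0l bl) addr0.
move=> h; apply/(videal_mulE vP _ _ (c := lf_unif K ^ lam)).
  by rewrite expfz_neq0.
by rewrite lf_val_unifXz addr0 mulrA -expfzDr // addrC subrK expr1z.
Qed.

Lemma rs_form_linear a u v w : form (a *: u + v) w = a * form u w + form v w.
Proof.
have [c hc <-] := lf_red_surj K a.
have [x hx <-] := rs_pr_surj u; have [y hy <-] := rs_pr_surj v.
have [z hz <-] := rs_pr_surj w.
rewrite -rs_prZ // -prD //; last exact: dualZ.
rewrite !rs_formE //; last exact: dual_scale_add.
have ix := dual_form_int hx hz; have iy := dual_form_int hy hz.
rewrite bl mulrDr mulrCA redD ?(redM hc) //; exact: lf_intM.
Qed.

Lemma rs_form_skew u v : form u v = - form v u.
Proof.
have [x hx <-] := rs_pr_surj u; have [y hy <-] := rs_pr_surj v.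
rewrite !rs_formE // bC mulrN redN //; exact: dual_form_int.
Qed.

Hypothesis A_sub : A `<=` dual.

(** A / B is spanned by the first half of the symplectic basis that comes with [theta], hence is
    isotropic; a zero residual form means that [varpi^(1 - lam) beta] has positive valuation. *)
Lemma lagr_isotropic theta a a' : @theta_function _ _ _ _ _ _ _ _ Q theta ->
  A a -> A a' -> videal vK lam (beta a a').
Proof.
move=> [_ _ _ [e [f [/(symplectic_basisP rs_form_linear rs_form_skew)[ef ex] _]]]].
move=> Aa Aa'.
have ax : pr a \in <<codom e>>%VS by rewrite ex; apply/rs_lagrE; exists a.
have ax' : pr a' \in <<codom e>>%VS by rewrite ex; apply/rs_lagrE; exists a'.
have : form (pr a) (pr a') = 0.
  case/span_codomP: ax => c ->; rewrite (sform_sumL rs_form_linear) big1 // => i _.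
  by move/(mem_lagr rs_form_linear rs_form_skew ef): ax' => ->; rewrite mulr0.
have [da da'] := (A_sub Aa, A_sub Aa').
rewrite rs_formE // => /(lf_red_ker (dual_form_int da da')).
have pi0 := lf_unif_neq0 K.
rewrite -{1}[1](subrK lam) -{1}(lf_val_unifXz K (1 - lam)).
by move/(videal_mulE vP); apply; rewrite expfz_neq0.
Qed.

End One.

Section Induced.
Variables (W W' : vectType k) (beta : W -> W -> k) (beta' : W' -> W' -> k).
Variables (A B : set W) (A' B' : set W').
Hypotheses (betaP : symplectic_form beta) (betaP' : symplectic_form beta').
Variables (Q : residualSpace K lam beta A B) (Q' : residualSpace K lam beta' A' B').
Local Notation dual := (dual_lattice K lam beta B).
Local Notation dual' := (dual_lattice K lam beta' B').
Variable f : 'Hom(W, W').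
Hypothesis fdual : forall w, dual w -> dual' (f w).
Hypothesis fB : forall w, B w -> B' (f w).

(** The body is that of [reduction], which is the case of an endomorphism. The inclusions of the W_i
    are another case. *)
Definition induced : 'Hom(rs_space Q, rs_space Q') :=
  linfun (fun y => rs_pr Q' (f (xget 0 [set w | dual w /\ rs_pr Q w = y]))).

Lemma inducedE w : dual w -> induced (rs_pr Q w) = rs_pr Q' (f w).
Proof.
pose F y := rs_pr Q' (f (xget 0 [set w | dual w /\ rs_pr Q w = y])).
have FE x : dual x -> F (rs_pr Q x) = rs_pr Q' (f x).
  move=> hx; rewrite /F; case: xgetP => [y _ [hy yx]|/(_ x)[]//].
  apply/(pr_eq betaP'); [exact: fdual..|].
  by rewrite -linearB; apply/fB/(pr_eq betaP Q).
rewrite /induced linfunE => [|a u v]; first exact: FE.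
have [c hc <-] := lf_red_surj K a.
have [x hx <-] := rs_pr_surj u; have [y hy <-] := rs_pr_surj v.
rewrite -rs_prZ // -(prD Q) //; last exact: dualZ.
rewrite -!/(F _) !FE //; last exact: dual_scale_add.
have [dx dy] := (fdual hx, fdual hy).
by rewrite linearD linearZ /= (prD Q') ?rs_prZ //; apply: dualZ.
Qed.

End Induced.

Section Reduction.
Variables (W : vectType k) (beta : W -> W -> k) (A B : set W).
Hypothesis betaP : symplectic_form beta.
Variable Q : residualSpace K lam beta A B.
Local Notation dual := (dual_lattice K lam beta B).
Local Notation pr := (rs_pr Q).
Local Notation form := (@rs_form _ _ _ _ _ _ _ _ Q).
Hypothesis (BA : B `<=` A) (A_sub : A `<=` dual).
Variable g : 'End(W).
Hypothesis gS : Sp beta g.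
Hypothesis gB : forall w, B w -> B (g w).
Hypothesis gVB : forall w, B w -> B ((g^-1)%VF w).

Lemma stable_dual w : dual w -> dual (g w).
Proof. by move=> hw b Bb; rewrite (Sp_inv betaP _ _ gS); apply/hw/gVB. Qed.

Lemma reductionE w : dual w -> reduction Q g (pr w) = pr (g w).
Proof. by apply: inducedE => //; exact: stable_dual. Qed.

Lemma reduction_Sp : Sp form (reduction Q g).
Proof.
move=> u v; have [x hx <-] := rs_pr_surj u; have [y hy <-] := rs_pr_surj v.
by rewrite !reductionE // !rs_formE ?gS //; apply: stable_dual.
Qed.

Hypothesis AP : additive_subgroup A.
Hypothesis dich :
  (forall w, A w -> A (g w)) \/ (forall w, A w -> A (g w) -> B w).

(** If [g] preserves A, its reduction [h] preserves the Lagrangian x and [S] is empty. In the other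
    case no nonzero vector of x is sent into x; so x and [h x] are transversal, [h x] is in duality
    with x and provides the complement [G], and [S] is everything. *)
Lemma reduction_normal_form (theta : 'End(rs_space Q) -> Fq) :
  theta_function theta ->
  exists l (E G : 'I_l -> rs_space Q) (S : {set 'I_l}) (C : 'M_l),
    [/\ sbasis form E G, <<codom E>>%VS = rs_lagr Q &
      forall m, reduction Q g (E m) =
        \sum_j C j m *: (if j \in S then G j else E j)].
Proof.
have formL := rs_form_linear betaP (Q := Q).
have formC := rs_form_skew betaP (Q := Q).
move=> [_ _ _ [e [f [/(symplectic_basisP formL formC)[ef ex] _]]]].
have lift y : y \in <<codom e>>%VS -> exists2 a, A a & pr a = y.
  by rewrite ex => /rs_lagrE.
case: dich => gA.
  have h m : {c | reduction Q g (e m) = \sum_j c j *: e j}.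
    apply: cid; apply/span_codomP.
    have [|a Aa <-] := lift (e m); first exact/memv_span/codom_f.
    by rewrite ex reductionE; [apply/rs_lagrE; exists (g a); [exact: gA|] | exact: A_sub].
  exists (rs_l Q), e, f, finset.set0, (\matrix_(j, m) sval (h m) j); split=> // m.
  by rewrite (svalP (h m)); apply: eq_bigr => j _; rewrite !inE mxE.
pose c := \matrix_(j < rs_l Q, m < rs_l Q) form (e j) (reduction Q g (e m)).
(* A kernel vector of the pairing matrix is a [y] in x with [h y] orthogonal to x, hence in x. A
   lift [a] of [y] in A then has [g a] in A, so it lies in B and [y = 0]. *)
have cu : c \in unitmx.
  rewrite -unitmx_tr -row_free_unit -kermx_eq0; apply/negPn/negP.
  case/rowV0Pn=> v /sub_kermxP vc /negP[]; apply/eqP.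
  pose y := \sum_m v 0 m *: e m.
  have yx : y \in <<codom e>>%VS by apply/span_codomP; exists (v 0).
  have hy : reduction Q g y \in <<codom e>>%VS.
    apply/(mem_lagr formL formC ef) => j; move/rowP: vc => /(_ j); rewrite !mxE.
    move=> <-; rewrite linear_sum /=.
    under eq_bigr do rewrite linearZ /=.
    rewrite (sform_sumR formL formC); apply: eq_bigr => m _.
    by rewrite !mxE.
  have [a Aa aE] := lift _ yx; have [a' Aa' aE'] := lift _ hy.
  have da := A_sub Aa; have da' := A_sub Aa'.
  have Ba : B a.
    apply: gA => //; rewrite -[g a](subrK a'); apply: asgD => //; apply: BA.
    by apply/(pr_eq betaP Q); rewrite ?aE' -?aE ?reductionE //; exact: stable_dual.
  have y0 : y = 0 by rewrite -aE; apply/rs_pr_ker.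
  apply/rowP=> j; rewrite mxE; have [_ efE _ _] := ef.
  have : form y (f j) = 0 by rewrite y0 (sform0l formL).
  rewrite (sform_sumL formL); under eq_bigr do rewrite efE.
  by rewrite sum_delta.
(* The basis of [h x] dual to [e]; inverting the relation, [h (e m)] is the sum of the
   [c j m *: G j]. *)
pose G j := \sum_m (invmx c) m j *: reduction Q g (e m).
exists (rs_l Q), e, G, [set: 'I_(rs_l Q)]%SET, c; split=> // [|m].
  apply: (sbasis_compl formL formC ef) => i j.
    rewrite /G (sform_sumR formL formC); have /matrixP/(_ i j) := mulmxV cu.
    by rewrite !mxE => <-; apply: eq_bigr => m _; rewrite !mxE mulrC.
  rewrite /G (sform_sumL formL) big1 // => m _.
  rewrite (sform_sumR formL formC) big1 ?mulr0 // => m' _.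
  by have [_ _ ee _] := ef; rewrite reduction_Sp ee mulr0.
under eq_bigr do rewrite finset.in_setT scaler_sumr.
rewrite exchange_big (bigD1 m) //= [X in _ + X]big1 ?addr0 => [|i im].
  under eq_bigr do rewrite scalerA mulrC.
  rewrite -scaler_suml; have /matrixP/(_ m m) := mulVmx cu.
  by rewrite [in RHS]mxE eqxx mxE => ->; rewrite scale1r.
under eq_bigr do rewrite scalerA mulrC.
rewrite -scaler_suml; have /matrixP/(_ i m) := mulVmx cu.
by rewrite [in RHS]mxE (negPf im) mxE => ->; rewrite scale0r.
Qed.

End Reduction.
End ResidualSpaces.

(** * Gauss sums *)

Section FiniteFields.
Variable F : finFieldType.

(** Squaring has fibers with at most two elements, and the fiber of 0 has only one, which makes the
    inequality strict. *)
Lemma card_squares : (#|F| < 2 * #|[set x ^+ 2 | x : F]%SET|)%N.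
Proof.
set S := [set x ^+ 2 | x : F]%SET.
have S0 : 0 \in S by apply/imsetP; exists 0; rewrite ?inE // expr0n.
have fiber y : (#|[pred x : F | x ^+ 2 == y]| <= 2 - (y == 0%R))%N.
  have [->|y0] := eqVneq y 0.
    rewrite (@eq_card _ _ (pred1 (0 : F))) ?card1 // => x.
    by rewrite !inE sqrf_eq0.
  have [x|h] := pickP [pred x : F | x ^+ 2 == y]; last by rewrite eq_card0.
  move=> /= /eqP xy; apply: (@leq_trans #|[set x; - x]%SET|).
    apply: subset_leq_card; apply/fintype.subsetP=> z; rewrite !inE -xy.
    by rewrite eqf_sqr.
  by rewrite cards2; case: eqP => // _; rewrite subn0.
have -> : #|F| = (\sum_(y in S) #|[pred x : F | x ^+ 2 == y]|)%N.
  rewrite -sum1_card (partition_big (fun x : F => x ^+ 2) (mem S)) /=.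
    by apply: eq_bigr => y _; rewrite sum1_card.
  by move=> x _; apply: imset_f.
rewrite (bigD1 0) //= (cardsD1 0) S0 mulnDr.
rewrite -addn1 addnAC leq_add //.
  by rewrite addn1 ltnS (leq_trans (fiber 0)) // eqxx.
rewrite mulnC -sum_nat_const; under [X in (_ <= X)%N]eq_bigl do rewrite in_setD1 andbC.
by apply: leq_sum => y /andP[_ y0]; rewrite (leq_trans (fiber y)) // leq_subr.
Qed.

(** The sets of values of [a x^2] and of [1 - b y^2] each contain more than half of the field, so
    they meet. *)
Lemma sum_two_squares (a b : F) : a != 0 -> b != 0 ->
  exists x y, a * x ^+ 2 + b * y ^+ 2 = 1.
Proof.
move=> a0 b0; pose S := [set x ^+ 2 | x : F]%SET.
pose S1 := [set a * x | x in S]%SET; pose S2 := [set 1 - b * x | x in S]%SET.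
have c1 : #|S1| = #|S| by apply: card_imset => x y /(mulfI a0).
have c2 : #|S2| = #|S|.
  by apply: card_imset => x y /addrI/oppr_inj/(mulfI b0).
have : S1 :&: S2 != finset.set0.
  apply/negP=> /eqP E; have := cardsUI S1 S2.
  rewrite E cards0 addn0 c1 c2 addnn -mul2n => U; have := card_squares.
  by rewrite -/S -U ltnNge max_card.
case/set0Pn=> z /finset.setIP[/imsetP[_ /imsetP[x _ ->] ->]].
case/imsetP=> _ /imsetP[y _ ->] E; exists x, y.
by rewrite E subrK.
Qed.

End FiniteFields.

Section GaussSums.
Variables (R : realType) (k : fieldType) (Fq : finFieldType).
Variables (K : localField k Fq) (psi : k -> R[i]) (lam : int).
Hypothesis psiP : unitary_character K psi lam.
Local Notation psibar := (psibar K psi lam).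
Local Notation omega := (omega K psi lam).
Let vP := lf_valP K.

Lemma psiD x y : psi (x + y) = psi x * psi y.
Proof. by case: psiP. Qed.

Lemma psi_norm x : `|psi x| = 1.
Proof. by case: psiP. Qed.

Lemma psi_neq0 x : psi x != 0.
Proof. by rewrite -normr_eq0 psi_norm oner_eq0. Qed.

Lemma psi0 : psi 0 = 1.
Proof.
have := psiD 0 0; rewrite addr0 -[LHS]mulr1 => /(mulfI (psi_neq0 0)).
by move=> <-.
Qed.

Lemma psi_lam x : videal (lf_val K) lam x -> psi x = 1.
Proof. by case: psiP => _ _ + _; apply. Qed.

Lemma psi_sum (I : finType) (c : I -> k) : psi (\sum_i c i) = \prod_i psi (c i).
Proof. exact: (big_morph psi psiD psi0). Qed.

Lemma psibarE z : lf_int K z -> psibar (lf_red K z) = psi (lf_unif K ^ (lam - 1) * z).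
Proof.
move=> hz; rewrite /Defs.psibar; case: xgetP => [y _ [hy yz]|/(_ z)[]//].
have pi0 := lf_unif_neq0 K.
rewrite -[y](subrK z) mulrDr psiD psi_lam ?mul1r //.
rewrite -{1}[lam](subrK 1) -{1}(lf_val_unifXz K (lam - 1)).
apply/(videal_mulE vP); first by rewrite expfz_neq0.
have nz : lf_int K (- z) by apply/(videalN vP).
by apply/(lf_red_ker (l := K)); [exact: (videalD vP) | rewrite redD // redN // yz subrr].
Qed.

Lemma psibarD x y : psibar (x + y) = psibar x * psibar y.
Proof.
have [x' hx <-] := lf_red_surj K x; have [y' hy <-] := lf_red_surj K y.
rewrite -redD // !psibarE //; first by rewrite mulrDr psiD.
exact: (videalD vP).
Qed.

Lemma psibar_neq0 x : psibar x != 0. Proof. exact: psi_neq0. Qed.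

Lemma psibar0 : psibar 0 = 1.
Proof.
have := psibarD 0 0; rewrite addr0 -[LHS]mulr1 => /(mulfI (psibar_neq0 0)).
by move=> <-.
Qed.

Lemma psibar_nontrivial : exists y, psibar y != 1.
Proof.
case: psiP => _ _ _ [x hx px]; have pi0 := lf_unif_neq0 K.
exists (lf_red K (lf_unif K ^ (1 - lam) * x)).
have E : lf_unif K ^ (lam - 1) * (lf_unif K ^ (1 - lam) * x) = x.
  by rewrite mulrA -expfzDr // (_ : _ + _ = 0) ?expr0z ?mul1r //; lia.
rewrite psibarE ?E //; apply/(videal_mulE vP _ _ (c := lf_unif K ^ (lam - 1))).
  by rewrite expfz_neq0.
by rewrite E addr0 lf_val_unifXz.
Qed.

Lemma psibar_sum a : \sum_t psibar (a * t) = if a == 0 then #|Fq|%:R else 0.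
Proof.
have [->|a0] := eqVneq a 0.
  by under eq_bigr do rewrite mul0r psibar0; rewrite sumr_const.
have [y py] := psibar_nontrivial.
have : psibar y * \sum_t psibar (a * t) = \sum_t psibar (a * t).
  rewrite mulr_sumr [RHS](reindex_inj (addrI (a^-1 * y))) /=.
  by apply: eq_bigr => t _; rewrite mulrDr mulVKf // psibarD.
move/eqP; rewrite -subr_eq0 -{2}[\sum_t _]mul1r -mulrBl mulf_eq0 subr_eq0.
by rewrite (negPf py) => /eqP.
Qed.

Local Notation gauss a := (\sum_(t : Fq) psibar (2^-1 * a * t ^+ 2)).

Lemma gaussM a b :
  gauss a * gauss b =
  \sum_(u : Fq * Fq) psibar (2^-1 * (a * u.1 ^+ 2 + b * u.2 ^+ 2)).
Proof.
rewrite big_distrlr pair_big /=; apply: eq_bigr => -[s t] _ /=.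
by rewrite -psibarD mulrDr !mulrA.
Qed.

(** The product with [gauss (- a)] is [q]: the form [s^2 - t^2] is hyperbolic, and in the
    coordinates [s + t], [s - t] the double sum is an orthogonality relation for [psibar]. *)
Lemma gauss_neq0 a : a != 0 -> gauss a != 0.
Proof.
move=> a0; have two0 := Fq_two_neq0 K.
have q0 : (#|Fq|%:R : R[i]) != 0.
  by rewrite pnatr_eq0 -lt0n; apply/card_gt0P; exists 0.
suff E : gauss a * gauss (- a) = #|Fq|%:R.
  by apply/eqP=> h; move/eqP: E; rewrite h mul0r eq_sym (negPf q0).
rewrite gaussM.
pose f (u : Fq * Fq) := (2^-1 * (u.1 + u.2), 2^-1 * (u.1 - u.2)).
have f_inj : injective f.
  apply: (can_inj (g := fun u => (u.1 + u.2, u.1 - u.2))) => -[s t].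
  by congr pair => /=; field.
rewrite (reindex_inj f_inj) /=.
transitivity (\sum_(u1 : Fq) \sum_(u2 : Fq) psibar (2^-1 * a * u1 * u2)).
  rewrite pair_big /=; apply: eq_bigr => -[s t] _ /=; congr psibar; field.
  exact: two0.
under eq_bigr do rewrite psibar_sum.
rewrite (bigD1 0) //= mulr0 eqxx big1 ?addr0 // => u u0.
by rewrite !mulf_eq0 invr_eq0 (negPf two0) (negPf a0) (negPf u0).
Qed.

(* A binary form represents 1, so [a s^2 + b t^2] is equivalent to
   [s^2 + a b t^2]. *)
Lemma gauss_mul a b : a != 0 -> b != 0 ->
  gauss a * gauss b = gauss 1 * gauss (a * b).
Proof.
move=> a0 b0; have [x [y xy]] := sum_two_squares a0 b0.
rewrite !gaussM.
(* The columns [(x, y)] and [(- b y, a x)] are orthogonal for the form, with values 1 and [a b]; the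
   determinant is [a x^2 + b y^2 = 1]. *)
pose f (u : Fq * Fq) := (x * u.1 - b * y * u.2, y * u.1 + a * x * u.2).
have f_inj : injective f.
  apply: (can_inj (g := fun u => (a * x * u.1 + b * y * u.2,
                                  x * u.2 - y * u.1))) => -[s t].
  congr pair => /=.
    by rewrite -[RHS]mul1r -xy; ring.
  by rewrite -[RHS]mul1r -xy; ring.
rewrite (reindex_inj f_inj) /=; apply: eq_bigr => -[s t] _ /=.
congr (psibar (_ * _)).
transitivity ((a * x ^+ 2 + b * y ^+ 2) * (s ^+ 2 + a * b * t ^+ 2)); first by ring.
by rewrite xy mul1r mul1r.
Qed.

Lemma sqrtq_neq0 : sqrtC (#|Fq|%:R : R[i]) != 0.
Proof.
rewrite sqrtC_eq0 pnatr_eq0 -lt0n; apply/card_gt0P; by exists 0.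
Qed.

Lemma omega_neq0 a : a != 0 -> omega a != 0.
Proof. by move=> a0; rewrite mulf_neq0 ?invr_eq0 ?sqrtq_neq0 ?gauss_neq0. Qed.

Lemma omegaM a b : a != 0 -> b != 0 ->
  omega a * omega b = omega 1 * omega (a * b).
Proof.
by move=> a0 b0; rewrite /Defs.omega mulrACA gauss_mul // mulrACA.
Qed.

Lemma omega_mod_squares a b : eq_mod_squares a b -> omega a = omega b.
Proof.
move=> [s s0 ->]; rewrite /Defs.omega; congr (_ * _).
rewrite [RHS](reindex_inj (mulfI s0)); apply: eq_bigr => t _ /=.
by congr psibar; ring.
Qed.

(** Each use of [omegaM] leaves one extra [omega 1], and each factor brings one through its exponent
    [1 - j]; they cancel, the empty product being [(omega 1)^-1 * omega 1]. *)
Lemma mfactor_prod n a (a_ : 'I_n -> Fq) j (j_ : 'I_n -> nat) :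
  (forall i, a_ i != 0) -> eq_mod_squares a (\prod_i a_ i) ->
  j = (\sum_i j_ i)%N ->
  (omega a)^-1 * omega 1 ^ (1 - j%:Z) =
  \prod_i ((omega (a_ i))^-1 * omega 1 ^ (1 - (j_ i)%:Z)).
Proof.
move=> a0 /omega_mod_squares-> ->; have w0 := omega_neq0 (oner_neq0 Fq).
have split1 m : omega 1 ^ (1 - m%:Z) = omega 1 * (omega 1 ^+ m)^-1.
  by rewrite expfzDr // expr1z exprnN.
elim: n a_ a0 j_ => [|n IHn] a_ a0 j_.
  by rewrite !big_ord0 subr0 expr1z mulVf.
rewrite !big_ord_recl -IHn //; set p := \prod_i _; set m := (\sum_i _)%N.
have p0 : p != 0 by apply/prodf_neq0 => i _.
rewrite !split1 exprD; have := omegaM (a0 ord0) p0.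
have := omega_neq0 (a0 ord0); have := omega_neq0 p0.
have := omega_neq0 (mulf_neq0 (a0 ord0) p0).
move: (omega _) (omega p) (omega (a_ ord0)) (omega 1) w0 => x y z w w0 x0 y0 z0 E.
have -> : x = z * y / w by rewrite E mulrAC divff // mul1r.
field; rewrite w0 y0 z0 !expf_neq0 //.
Qed.

End GaussSums.

(** * Representatives and the Weil operator *)

(** Distributivity with an index type that varies with the factor, as each A_i has its own
    transversal. *)
Lemma prod_sum_fprod (R : comPzSemiRingType) (I : finType) (T_ : I -> finType)
    (P : forall i, T_ i -> R) :
  \prod_i \sum_(j : T_ i) P i j = \sum_(t : fprod T_) \prod_i P i (t i).
Proof.
under eq_bigr do rewrite big_tag.
rewrite bigA_distr_big_dep.
have -> : \sum_(t : fprod T_) \prod_i P i (t i) =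
    \sum_(t : fprod T_) \prod_(i in I) (finfun (P i)) (t i).
  by apply: eq_bigr => t _; apply: eq_bigr => i _; rewrite ffunE.
rewrite big_fprod; apply: eq_bigr => f _; apply: eq_bigr => i _.
by rewrite /untag; case: eqP => // e; rewrite ffunE.
Qed.

Lemma fsbig_setT (R : Type) (idx : R) (op : Monoid.com_law idx) (I : finType)
    (F : I -> R) :
  \big[op/idx]_(i \in [set: I]) F i = \big[op/idx]_i F i.
Proof.
rewrite [RHS](bigfs _ (P := xpredT)) ?index_enum_uniq //.
  by apply: eq_fsbigl; apply/seteqP; split.
by move=> i _; rewrite mem_index_enum.
Qed.

Lemma finite_vect (F : finFieldType) (V : vectType F) : finite_set [set: V].
Proof.
pose f (c : {ffun 'I_(\dim {:V}) -> F}) := \sum_i c i *: (vbasis {:V})`_i.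
have -> : [set: V] = f @` setT.
  apply/seteqP; split=> // v _; exists [ffun i => coord (vbasis {:V}) i v] => //.
  rewrite [RHS](coord_vbasis (memvf v)).
  by apply: eq_bigr => i _; rewrite ffunE.
apply: finite_image; exact: finite_finset.
Qed.

Section Representatives.
Variables (k : fieldType) (W : vectType k) (M L : set W).
Hypothesis LP : additive_subgroup L.

Definition rep a := xget 0 [set x | M x /\ L (x - a)].

Lemma repP a : M a -> M (rep a) /\ L (rep a - a).
Proof.
move=> Ma; rewrite /rep; case: xgetP => [x _ //|/(_ a)[]].
by rewrite /= subrr; split=> //; case: LP.
Qed.

Lemma rep_eq a b : L (a - b) -> rep a = rep b.
Proof.
move=> ab; rewrite /rep; congr (xget 0); apply/seteqP; split=> x /= [Mx h]; split=> //.
  by rewrite -(subrKA a x (- b)); apply: asgD.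
by rewrite -(subrKA b x (- a)); apply: asgD => //; rewrite -opprB; apply: asgN.
Qed.

Lemma reps_rep a : M a -> reps M L (rep a).
Proof. by exists a. Qed.

Lemma mem_reps r : reps M L r -> M r.
Proof. by case=> a Ma <-; case: (repP Ma). Qed.

Lemma rep_id r : reps M L r -> rep r = r.
Proof. by case=> a Ma <-; apply: rep_eq; case: (repP Ma). Qed.

Lemma reps_eq r r' : reps M L r -> reps M L r' -> L (r - r') -> r = r'.
Proof. by move=> /rep_id{2}<- /rep_id{2}<-; apply: rep_eq. Qed.

Section Transversal.
Variables (I : finType) (x : I -> W).
Hypothesis xM : forall i, M (x i).
Hypothesis x_cover : forall a, M a -> exists i, L (x i - a).
Hypothesis x_inj : forall i j, L (x i - x j) -> i = j.

Let rep_inj : injective (rep \o x).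
Proof.
move=> i j /= E; apply: x_inj; have [_ hi] := repP (xM i).
have [_ hj] := repP (xM j); rewrite -(subrKA (rep (x i))); apply: asgD => //.
  by rewrite -opprB; apply: asgN.
by rewrite E.
Qed.

Let repsE : reps M L = (rep \o x) @` setT.
Proof.
apply/seteqP; split=> [_ [a Ma <-]|_ [i _ <-]]; last exact: reps_rep.
by have [i /rep_eq E] := x_cover Ma; exists i.
Qed.

Lemma reps_finite : finite_set (reps M L).
Proof. rewrite repsE; apply: finite_image; exact: finite_finset. Qed.

(** Frees the sums from the representatives picked by [xget], so that a transversal adapted to the
    decomposition can be used. *)
Lemma big_reps (R : Type) (idx : R) (op : Monoid.com_law idx) (G : W -> R) :
  (forall a b, M a -> M b -> L (a - b) -> G a = G b) ->
  \big[op/idx]_(a \in reps M L) G a = \big[op/idx]_i G (x i).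
Proof.
move=> GL; rewrite repsE fsbig_image; last by move=> i j _ _; apply: rep_inj.
rewrite fsbig_setT; apply: eq_bigr => i _ /=.
by have [h1 h2] := repP (xM i); apply: GL.
Qed.

Lemma lat_index_transversal : lat_index M L = #|I|.
Proof.
rewrite /lat_index -sum1_size -(fsbig_finite _ _ reps_finite).
by rewrite big_reps // sum1_card.
Qed.

End Transversal.
End Representatives.

Section Quasiperiodic.
Variables (R : realType) (k : fieldType) (Fq : finFieldType).
Variables (K : localField k Fq) (psi : k -> R[i]) (lam : int).
Hypothesis psiP : unitary_character K psi lam.

Section WeilSum.
Variables (W : vectType k) (beta : W -> W -> k) (A B : set W).
Hypothesis betaP : symplectic_form beta.
Variables (Q : residualSpace K lam beta A B) (theta : 'End(rs_space Q) -> Fq).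
Hypothesis AP : additive_subgroup A.
Hypothesis A_iso : forall a b, A a -> A b -> videal (lf_val K) lam (beta a b).
Variable g : 'End(W).
Hypothesis gS : Sp beta g.
Variable phi : W -> R[i].
Hypothesis phiA : forall a w, A a -> phi (a + w) = psi (2^-1 * beta w a) * phi w.

Lemma capg_subgroup : additive_subgroup (A `&` g @` A).
Proof.
split=> [|x y [Ax [a Aa ax]] [Ay [b Ab bx]]].
  by split; [exact: asg0 | exists 0; rewrite ?linear0 //; exact: asg0].
by split; [exact: asgB | exists (a - b); [exact: asgB | rewrite linearB /= ax bx]].
Qed.

(** Replacing [a] by [a + g a'] brings out [psi (2^-1 * beta (a + w) (g a'))] by quasi-periodicity.
    Its part in [w] cancels against the explicit phase, and the rest is 1 because [a] and [g a']
    both lie in A. *)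
Lemma weil_op_transversal (I : finType) (x : I -> W) w :
  (forall i, A (x i)) ->
  (forall a, A a -> exists i, (A `&` g @` A) (x i - a)) ->
  (forall i j, (A `&` g @` A) (x i - x j) -> i = j) ->
  weil_op psi theta g phi w =
    mfactor psi theta (reduction Q g) * sqrtC #|Fq|%:R ^+ rs_j (reduction Q g)
    * (#|I|%:R)^-1
    * \sum_i psi (2^-1 * beta (x i) w) * phi ((g^-1)%VF (x i + w)).
Proof.
move=> xA xc xi; rewrite /weil_op; have LP := capg_subgroup.
rewrite (lat_index_transversal LP xA xc xi); congr (_ * _).
apply: (big_reps LP xA xc xi) => a b Aa Ab [Al [a' Aa' la]].
have g0 := symp_Sp_inj betaP gS.
have bl := symp_linearl betaP; have bC := symp_skew betaP.
have bD u v z : beta (u + v) z = beta u z + beta v z by rewrite (sformDl bl).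
have -> : a = b + g a' by rewrite la addrC subrK.
have -> : (g^-1)%VF (b + g a' + w) = a' + (g^-1)%VF (b + w).
  by rewrite addrAC addrC linearD /= lker0_lfunK.
rewrite phiA // mulrA -(psiD psiP) bD.
have -> : beta ((g^-1)%VF (b + w)) a' = beta (b + w) (g a').
  by rewrite [RHS]bC (Sp_inv betaP) // -bC.
rewrite bD -mulrDr.
have -> : beta b w + beta (g a') w + (beta b (g a') + beta w (g a')) =
    beta b w + beta b (g a').
  by rewrite [beta (g a') w]bC; ring.
rewrite mulrDr (psiD psiP) [X in _ * X * _](psi_lam psiP) ?mulr1 //.
by apply/videal_half/A_iso; rewrite // la.
Qed.

End WeilSum.

Definition sqmod (z : R[i]) : R := complex.Re (`|z| ^+ 2).

Lemma sqmod_normc z : sqmod z = Normc.normc z ^+ 2.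
Proof. by case: z => a b; rewrite /sqmod normc_def -rmorphXn. Qed.

Lemma sqmod_ge0 z : 0 <= sqmod z.
Proof. by rewrite sqmod_normc sqr_ge0. Qed.

Lemma sqmod1 : sqmod 1 = 1.
Proof. by rewrite /sqmod normr1 expr1n. Qed.

Lemma sqmodM y z : sqmod (y * z) = sqmod y * sqmod z.
Proof. by rewrite !sqmod_normc Normc.normcM exprMn. Qed.

Lemma sqmod_prod (I : finType) (z : I -> R[i]) :
  sqmod (\prod_i z i) = \prod_i sqmod (z i).
Proof. exact: (big_morph sqmod sqmodM sqmod1). Qed.

Lemma sqmod_psi x z : sqmod (psi x * z) = sqmod z.
Proof. by rewrite /sqmod normrM (psi_norm psiP) mul1r. Qed.

Lemma sqmod_periodic (W : vectType k) (beta : W -> W -> k) (A : set W)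
    (phi : W -> R[i]) x y :
  (forall a w, A a -> phi (a + w) = psi (2^-1 * beta w a) * phi w) ->
  A (x - y) -> sqmod (phi x) = sqmod (phi y).
Proof. by move=> phiA Axy; rewrite -{1}[x](subrK y) phiA // sqmod_psi. Qed.

(** [f] separates cosets of A by cosets of A', so the left side is the sum of a subfamily of the
    nonnegative terms on the right. *)
Lemma sqnorm_comp (W W' : vectType k) (beta' : W' -> W' -> k)
    (A : set W) (A' : set W') (f : W -> W') (phi : W' -> R[i]) :
  additive_subgroup A -> additive_subgroup A' ->
  (forall x y, A' (f x - f y) -> A (x - y)) ->
  (forall a w, A' a -> phi (a + w) = psi (2^-1 * beta' w a) * phi w) ->
  (sqnorm A (phi \o f) <= sqnorm A' phi)%E.
Proof.
move=> AP AP' fA phiA; pose F w := rep setT A' (f w).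
have FP w : A' (F w - f w) by case: (repP (M := setT) AP' (a := f w)).
have -> : sqnorm A (phi \o f) = (\esum_(w in reps setT A) (sqmod (phi (F w)))%:E)%R.
  apply: eq_esum => w _; congr EFin; apply/esym/(sqmod_periodic phiA).
  exact: FP.
rewrite -(esum_image _ F (fun w => (sqmod (phi w))%:E)).
  apply: le_ereal_sup => _ [X [finX XS] <-]; exists X => //; split=> // y /XS.
  by case=> w _ <-; apply: reps_rep.
move=> x y; rewrite !inE => hx hy E; apply: (reps_eq AP hx hy); apply: fA.
rewrite -(subrKA (F x)); apply: asgD => //.
  by rewrite -opprB; apply: asgN.
by rewrite E.
Qed.

End Quasiperiodic.

(** * Orthogonal decompositions *)

Section Decomposition.
Variables (k : fieldType) (W : vectType k) (beta : W -> W -> k).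
Hypothesis betaP : symplectic_form beta.
Variables (T : set 'End(W)) (n : nat) (Ws : 'I_n -> {vspace W}).
Hypotheses (TS : T `<=` Sp beta) (Tgroup : subgroup T).
Hypothesis WsP : torus_decomposition beta T Ws.
Local Notation comp := (component Ws).

Lemma component_linear i : linear (comp i).
Proof. by move=> a x y; rewrite /component !linearP. Qed.

HB.instance Definition _ i :=
  GRing.isLinear.Build k W (subvs_of (Ws i)) *:%R (comp i) (component_linear i).

Lemma comp_sumK w : \sum_i vsval (comp i w) = w.
Proof.
have [[sumW _] _ _ _ _] := WsP.
rewrite -[RHS](sumv_pi_sum (erefl (\sum_(j < n) Ws j)%VS)); last by rewrite sumW memvf.
by apply: eq_bigr => i _; rewrite /component vsprojK // memv_sum_pi.
Qed.

Lemma comp_sum_mem (v : 'I_n -> W) i :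
  (forall j, v j \in Ws j) -> vsval (comp i (\sum_j v j)) = v i.
Proof.
have [[_ dW] _ _ _ _] := WsP => hv.
have /directv_sum_unique := dW.
move=> /(_ (fun j => vsval (comp j (\sum_j v j))) v).
rewrite comp_sumK eqxx => /(_ (fun j _ => subvsP _) (fun j _ => hv j)).
by move/esym/forall_inP => /(_ i isT)/eqP.
Qed.

Lemma comp_sum (y : forall i, subvs_of (Ws i)) i : comp i (\sum_j vsval (y j)) = y i.
Proof.
apply: val_inj; apply: (comp_sum_mem (v := fun j => vsval (y j))) => j.
exact: subvsP.
Qed.

Lemma comp_vsval_sum i (y : subvs_of (Ws i)) j :
  vsval (comp j (vsval y)) = if j == i then vsval y else 0.
Proof.
rewrite -(comp_sum_mem (v := fun j => if j == i then vsval y else 0)).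
  by rewrite -big_mkcond big_pred1_eq.
by move=> m; case: eqP => [->|_]; [exact: subvsP | exact: mem0v].
Qed.

Lemma comp_vsval i (y : subvs_of (Ws i)) : comp i (vsval y) = y.
Proof. by apply: val_inj; rewrite /= comp_vsval_sum eqxx. Qed.

Lemma comp_vsval_neq i j (y : subvs_of (Ws i)) : j != i -> comp j (vsval y) = 0.
Proof. by move=> /negPf ji; apply: val_inj; rewrite /= comp_vsval_sum ji. Qed.

Lemma comp_inj x y : (forall i, comp i x = comp i y) -> x = y.
Proof.
by move=> h; rewrite -[x]comp_sumK -[y]comp_sumK; apply: eq_bigr => i _; rewrite h.
Qed.

Lemma sub_formP i : symplectic_form (sub_form beta Ws i).
Proof. by case: WsP => _ _ + _ _; apply. Qed.

Lemma beta_orth i j x y : i != j -> x \in Ws i -> y \in Ws j -> beta x y = 0.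
Proof. by case: WsP => _ h _ _ _ ij; apply: h. Qed.

Lemma beta_vsval i (y : subvs_of (Ws i)) w :
  beta (vsval y) w = sub_form beta Ws i y (comp i w).
Proof.
have bl := symp_linearl betaP; have bC := symp_skew betaP.
rewrite -{1}[w]comp_sumK (eq_bigr (fun j => 1 *: vsval (comp j w))); last first.
  by move=> j _; rewrite scale1r.
rewrite (sform_sumR bl bC) (bigD1 i) //= mul1r big1 ?addr0 // => j ji.
by rewrite mul1r (beta_orth (i := i) (j := j)) ?subvsP // eq_sym.
Qed.

Lemma beta_sum x y : beta x y = \sum_i sub_form beta Ws i (comp i x) (comp i y).
Proof.
have bl := symp_linearl betaP.
rewrite -{1}[x]comp_sumK (eq_bigr (fun j => 1 *: vsval (comp j x))); last first.
  by move=> j _; rewrite scale1r.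
by rewrite (sform_sumL bl); apply: eq_bigr => i _; rewrite mul1r beta_vsval.
Qed.

Lemma T_stable g i x : T g -> x \in Ws i -> g x \in Ws i.
Proof.
move=> Tg xi; have [_ _ _ /(_ i)[_ h _] _] := WsP.
by apply: (subvP (h _ Tg)); apply: memv_img.
Qed.

Lemma restrE g i y : T g -> vsval (restr Ws i g y) = g (vsval y).
Proof.
move=> Tg; rewrite /restr linfunE.
  by rewrite vsprojK // T_stable // subvsP.
by move=> a x z; rewrite !linearP.
Qed.

Lemma comp_T g i w : T g -> comp i (g w) = restr Ws i g (comp i w).
Proof.
move=> Tg; apply: val_inj; rewrite /= restrE // -{1}[w]comp_sumK linear_sum.
apply: (comp_sum_mem (v := fun j => g (vsval (comp j w)))) => j.
by apply: T_stable => //; exact: subvsP.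
Qed.

Lemma T_ext g h : T g -> T h -> (forall i, restr Ws i g = restr Ws i h) -> g = h.
Proof.
move=> Tg Th E; apply/lfunP=> w; apply: comp_inj => i.
by rewrite !comp_T // E.
Qed.

Lemma T1 : T \1%VF. Proof. by case: Tgroup. Qed.

Lemma TV g : T g -> T (g^-1)%VF. Proof. by case: Tgroup => _ _; apply. Qed.

Lemma TM g h : T g -> T h -> T (g \o h)%VF.
Proof. by case: Tgroup => _ + _; apply. Qed.

Lemma restr1 i : restr Ws i \1%VF = \1%VF.
Proof. by apply/lfunP=> y; apply: val_inj; rewrite /= restrE ?id_lfunE //; exact: T1. Qed.

Lemma restrM i g h : T g -> T h ->
  restr Ws i (g \o h)%VF = (restr Ws i g \o restr Ws i h)%VF.
Proof.
move=> Tg Th; apply/lfunP=> y; apply: val_inj.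
by rewrite /= comp_lfunE !restrE ?comp_lfunE ?restrE //; exact: TM.
Qed.

Lemma restr_Sp i g : T g -> Sp (sub_form beta Ws i) (restr Ws i g).
Proof. by move=> Tg x y; rewrite /sub_form !restrE // (TS Tg). Qed.

Lemma comp_TV g i w : T g -> comp i ((g^-1)%VF w) = (restr Ws i g)^-1%VF (comp i w).
Proof.
move=> Tg; have g0 := symp_Sp_inj betaP (TS Tg).
have r0 := symp_Sp_inj (sub_formP i) (restr_Sp (i := i) Tg).
by rewrite -{2}(lker0_lfunVK g0 w) comp_T // lker0_lfunK.
Qed.

Lemma restrV i g : T g -> (restr Ws i g)^-1%VF = restr Ws i (g^-1)%VF.
Proof.
move=> Tg; apply/lfunP=> y; rewrite -{1}(comp_vsval y) -comp_TV // comp_T ?comp_vsval //.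
exact: TV.
Qed.

Lemma torus_glue (g : 'I_n -> 'End(W)) : (forall i, T (g i)) ->
  exists2 h, T h & forall i, restr Ws i h = restr Ws i (g i).
Proof.
by move=> Tg; have [_ _ _ _] := WsP; apply=> i; exists (g i).
Qed.

Lemma embedE i (t : 'End(subvs_of (Ws i))) w :
  embed Ws i t w = w - vsval (comp i w) + vsval (t (comp i w)).
Proof.
rewrite /embed linfunE // => a x y; rewrite !linearP /= scalerDr scalerBr.
by rewrite scalerN [X in X + _ = _]addrACA [LHS]addrACA.
Qed.

(** Membership in T comes from the product decomposition: gluing [g] at [i] with the identity
    elsewhere gives an element of T, and it has the same components as the embedding. *)
Lemma embed_restr i g : T g -> [/\ T (embed Ws i (restr Ws i g)),
  restr Ws i (embed Ws i (restr Ws i g)) = restr Ws i g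
  & forall j, j != i -> restr Ws j (embed Ws i (restr Ws i g)) = \1%VF].
Proof.
move=> Tg.
have [|h Th hE] := @torus_glue (fun j => if j == i then g else \1%VF).
  by move=> j; case: eqP => _ //; exact: T1.
have -> : embed Ws i (restr Ws i g) = h.
  apply/lfunP=> w; apply: comp_inj => j; rewrite embedE comp_T // hE.
  rewrite linearD linearB /=; case: (eqVneq j i) => [->|ji].
    by rewrite !comp_vsval subrr add0r.
  by rewrite !comp_vsval_neq // subr0 addr0 restr1 id_lfunE.
split=> // [|j /negPf ji]; first by rewrite hE eqxx.
by rewrite hE ji restr1.
Qed.

Lemma character_prod (R : realType) (v : k -> int) (chi : 'End(W) -> R[i]) g :
  character v T chi -> T g -> chi g = \prod_i chi (embed Ws i (restr Ws i g)).
Proof.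
move=> [chi1 chiM _] Tg.
(* Induction on the number [m] of components already equal to those of [g]. The partial element [h]
   is known only by its components, which determine it by [T_ext]. *)
have H m h : T h ->
    (forall j : 'I_n, restr Ws j h = restr Ws j (if (j < m)%N then g else \1%VF)) ->
    chi h = \prod_(j < n | (j < m)%N) chi (embed Ws j (restr Ws j g)).
  elim: m h => [|m IHm] h Th hE.
    rewrite big_pred0 // (_ : h = \1%VF) //.
    by apply: T_ext => //; exact: T1.
  have [mn|nm] := ltnP m n; last first.
    rewrite (IHm _ Th).
      apply: eq_bigl => j; have jn := ltn_ord j; apply/idP/idP; lia.
    move=> j; rewrite hE; have jn := ltn_ord j.
    by rewrite (leq_trans jn nm) (leq_trans jn (leqW nm)).
  have [|h' Th' hE'] := @torus_glue (fun j => if (j < m)%N then g else \1%VF).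
    by move=> j; case: ifP => _ //; exact: T1.
  pose i := Ordinal mn; have [Te ei ej] := embed_restr i Tg.
  have -> : h = (embed Ws i (restr Ws i g) \o h')%VF.
    apply: T_ext => //; first exact: TM.
    move=> j; rewrite restrM // hE hE'; have [->|ji] := eqVneq j i.
      by rewrite ei /= ltnSn ltnn restr1 comp_lfun1r.
    rewrite ej // comp_lfun1l; congr (restr Ws j (if _ then _ else _)).
    by rewrite ltnS leq_eqVlt (_ : (j == m :> nat) = false) //; apply/negbTE.
  rewrite chiM // (IHm _ Th' hE') [RHS](bigD1 i) ?ltnSn //=.
  congr (_ * _); apply: eq_bigl => j; rewrite -val_eqE /=; lia.
rewrite (H n g Tg); first by apply: eq_bigl => j; rewrite ltn_ord.
by move=> j; rewrite ltn_ord.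
Qed.

End Decomposition.

(** * Gluing normal forms *)

(** The data of [theta_normal_form] collected in one type, so that a normal form can be chosen
    simultaneously for every [i]. *)
Record normal_form (F : fieldType) (V : vectType F) (form : V -> V -> F)
    (x : {vspace V}) (h : 'End(V)) := NormalForm {
  nf_l : nat;
  nf_E : 'I_nf_l -> V;
  nf_G : 'I_nf_l -> V;
  nf_S : {set 'I_nf_l};
  nf_C : 'M[F]_nf_l;
  nf_basis : sbasis form nf_E nf_G;
  nf_lagr : <<codom nf_E>>%VS = x;
  nf_mx : forall m, h (nf_E m) =
    \sum_j nf_C j m *: (if j \in nf_S then nf_G j else nf_E j) }.

Arguments nf_E {F V form x h} n _.
Arguments nf_G {F V form x h} n _.
Arguments nf_mx {F V form x h} n _.

Lemma big_rank (R : Type) (idx : R) (op : Monoid.com_law idx) n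
    (l : 'I_n -> nat) (X : 'I_(\sum_i l i)%N -> R) :
  \big[op/idx]_s X s = \big[op/idx]_i \big[op/idx]_(j < l i) X (tagnat.Rank i j).
Proof.
rewrite (sig_big_dep xpredT (fun _ => xpredT) (fun i j => X (tagnat.Rank i j))).
rewrite (reindex (@tagnat.rank _ l)); last exact: onW_bij (@tagnat.rank_bij _ l).
by apply: eq_bigr => -[i j] _.
Qed.

Section Lattices.
Variables (k : fieldType) (Fq : finFieldType) (K : localField k Fq) (lam : int).
Variables (W : vectType k) (beta : W -> W -> k).
Hypothesis betaP : symplectic_form beta.
Variables (T : set 'End(W)) (n : nat) (Ws : 'I_n -> {vspace W}).
Hypotheses (TS : T `<=` Sp beta) (Tgroup : subgroup T).
Hypothesis WsP : torus_decomposition beta T Ws.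
Local Notation comp := (component Ws).
Local Notation sbeta := (sub_form beta Ws).
Variables (As Bs : forall i, set (subvs_of (Ws i))).
Arguments As : clear implicits.
Arguments Bs : clear implicits.
Local Notation A := (sum_lattice As).
Local Notation B := (sum_lattice Bs).
Local Notation dual := (dual_lattice K lam beta B).
Local Notation duals i := (dual_lattice K lam (sbeta i) (Bs i)).
Hypothesis AsP : forall i, additive_subgroup (As i).
Hypothesis BsP : forall i, additive_subgroup (Bs i).
Hypothesis BAs : forall i, Bs i `<=` As i.
Hypothesis ADs : forall i, As i `<=` duals i.
Hypothesis TBs : forall i g y, T g -> Bs i y -> Bs i (restr Ws i g y).
Hypothesis dichs : forall i g, T g ->
  (forall y, As i y -> As i (restr Ws i g y)) \/
  (forall y, As i y -> As i (restr Ws i g y) -> Bs i y).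
Let sbP i := sub_formP WsP i.

Lemma sum_lattice_subgroup (L : forall i, set (subvs_of (Ws i))) :
  (forall i, additive_subgroup (L i)) -> additive_subgroup (sum_lattice L).
Proof.
move=> LP; split=> [i|x y hx hy i]; first by rewrite linear0; apply: asg0.
by rewrite linearB; apply: asgB.
Qed.

Lemma sum_lattice_vsval (L : forall i, set (subvs_of (Ws i))) i y :
  (forall i, additive_subgroup (L i)) -> L i y -> sum_lattice L (vsval y).
Proof.
move=> LP Ly j; have [E|ji] := eqVneq j i; first by subst j; rewrite (comp_vsval WsP).
by rewrite (comp_vsval_neq WsP) //; apply: asg0.
Qed.

Lemma dual_sumP w : dual w <-> forall i, duals i (comp i w).
Proof.
split=> h => [i b Bb|b Bb].
  have := h _ (sum_lattice_vsval BsP Bb).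
  rewrite (symp_skew betaP) (beta_vsval betaP WsP) -(symp_skew (sbP i)).
  by [].
rewrite (beta_sum betaP WsP); apply: big_ind; first by left.
  by move=> x y; apply: (videalD (lf_valP K)).
by move=> i _; apply: h.
Qed.

Lemma dual_vsval i y : duals i y -> dual (vsval y).
Proof.
move=> hy; apply/dual_sumP=> j; have [E|ji] := eqVneq j i.
  by subst j; rewrite (comp_vsval WsP).
by rewrite (comp_vsval_neq WsP) //; apply: dual0.
Qed.

Lemma AP : additive_subgroup A. Proof. exact: sum_lattice_subgroup. Qed.

Lemma BA : B `<=` A. Proof. by move=> w Bw i; apply/BAs/Bw. Qed.

Lemma AD : A `<=` dual.
Proof. by move=> w Aw; apply/dual_sumP=> i; apply/ADs/Aw. Qed.

Lemma TB g w : T g -> B w -> B (g w).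
Proof. by move=> Tg Bw i; rewrite (comp_T WsP) //; apply: TBs. Qed.

Lemma TBVs i g y : T g -> Bs i y -> Bs i ((restr Ws i g)^-1%VF y).
Proof.
move=> Tg By; rewrite (restrV betaP TS Tgroup WsP) //.
by apply: TBs => //; apply: TV.
Qed.

Lemma capg_sumP g z : T g ->
  (A `&` g @` A) z <->
  forall i, (As i `&` restr Ws i g @` As i) (comp i z).
Proof.
move=> Tg; split=> [[Az [a Aa E]] i|h].
  split; first exact: Az.
  by exists (comp i a); [exact: Aa | rewrite -(comp_T WsP) // E].
have g0 := symp_Sp_inj betaP (TS Tg).
split=> [i|]; first by case: (h i).
exists ((g^-1)%VF z); last by rewrite lker0_lfunVK.
move=> i; rewrite (comp_TV betaP TS WsP) //; case: (h i) => _ [a Aa <-].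
by rewrite lker0_lfunK // (symp_Sp_inj (sbP i)) //; apply: (restr_Sp TS WsP).
Qed.

Variable Q : residualSpace K lam beta A B.
Variable Qs : forall i, residualSpace K lam (sbeta i) (As i) (Bs i).
Local Notation b := (rs_space Q).
Local Notation pr := (rs_pr Q).
Local Notation form := (@rs_form _ _ _ _ _ _ _ _ Q).
Local Notation forms i := (@rs_form _ _ _ _ _ _ _ _ (Qs i)).

Definition res_embed i : 'Hom(rs_space (Qs i), b) :=
  induced (Qs i) Q (linfun vsval).
Local Notation iota := res_embed.

Lemma res_embedE i y : duals i y -> iota i (rs_pr (Qs i) y) = pr (vsval y).
Proof.
move=> hy; rewrite /res_embed inducedE ?lfunE // => w; rewrite lfunE /=.
  exact: dual_vsval.
exact: sum_lattice_vsval.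
Qed.

Lemma rs_pr_sum w : dual w -> pr w = \sum_i iota i (rs_pr (Qs i) (comp i w)).
Proof.
move=> hw; rewrite -{1}(comp_sumK WsP w).
have hi := (dual_sumP w).1 hw.
suff [] : dual (\sum_i vsval (comp i w)) /\
    pr (\sum_i vsval (comp i w)) = \sum_i iota i (rs_pr (Qs i) (comp i w)) by [].
apply: (big_ind2 (fun x y => dual x /\ pr x = y)).
- by split; [exact: dual0 | exact: pr0].
- move=> x1 x2 y1 y2 [d1 e1] [d2 e2]; split; first exact: dualD.
  by rewrite (prD Q) // e1 e2.
- by move=> i _; rewrite res_embedE //; split=> //; apply: dual_vsval.
Qed.

Lemma res_embed_form i u v : form (iota i u) (iota i v) = forms i u v.
Proof.
have [x hx <-] := rs_pr_surj u; have [y hy <-] := rs_pr_surj v.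
by rewrite !res_embedE // !rs_formE //; exact: dual_vsval.
Qed.

Lemma res_embed_orth i j u v : i != j -> form (iota i u) (iota j v) = 0.
Proof.
move=> ij; have [x hx <-] := rs_pr_surj u; have [y hy <-] := rs_pr_surj v.
rewrite !res_embedE // !rs_formE; [|exact: dual_vsval..].
by rewrite (beta_orth WsP ij) ?subvsP // mulr0 red0.
Qed.

Variable g : 'End(W).
Hypothesis Tg : T g.
Let gB w : B w -> B (g w). Proof. exact: TB. Qed.
Let gVB w : B w -> B ((g^-1)%VF w). Proof. by apply: TB; apply: TV. Qed.
Let gBs i y : Bs i y -> Bs i (restr Ws i g y). Proof. exact: TBs. Qed.
Let gVBs i y : Bs i y -> Bs i ((restr Ws i g)^-1%VF y). Proof. exact: TBVs. Qed.
Let gS : Sp beta g := TS Tg.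
Let gSs i : Sp (sbeta i) (restr Ws i g) := restr_Sp TS WsP (i := i) Tg.

Lemma reduction_res_embed i u :
  reduction Q g (iota i u) = iota i (reduction (Qs i) (restr Ws i g) u).
Proof.
have [y hy <-] := rs_pr_surj u.
rewrite (reductionE (sbP i) (Qs i) (@gSs i) (gBs (i := i)) (gVBs (i := i))) //.
have hgy : duals i (restr Ws i g y) by apply: (stable_dual (sbP i)) => //; exact: gVBs.
rewrite !res_embedE // reductionE //; last exact: dual_vsval.
by rewrite (restrE WsP).
Qed.

Section Glue.
Variable nf : forall i,
  normal_form (forms i) (rs_lagr (Qs i)) (reduction (Qs i) (restr Ws i g)).
Local Notation l := (fun i => nf_l (nf i)).
Local Notation N := (\sum_i nf_l (nf i))%N.
Local Notation pairs := {i : 'I_n & 'I_(nf_l (nf i))}.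

Definition glue (X : forall i, 'I_(nf_l (nf i)) -> rs_space (Qs i)) (p : pairs) : b :=
  iota (tag p) (X (tag p) (tagged p)).

Local Notation E := (fun s : 'I_N => glue (fun i => nf_E (nf i)) (tagnat.sig s)).
Local Notation G := (fun s : 'I_N => glue (fun i => nf_G (nf i)) (tagnat.sig s)).
Local Notation S := [set s : 'I_N | tagged (tagnat.sig s) \in nf_S (nf (tag (tagnat.sig s)))]%SET.
Local Notation C := (\mxdiag_i nf_C (nf i)).

Lemma glue_form X Y c :
  (forall i u v, forms i (X i u) (Y i v) = if u == v then c else 0) ->
  forall p q, form (glue X p) (glue Y q) = if p == q then c else 0.
Proof.
move=> h [i u] [j v]; rewrite /glue /=; have [E|ij] := eqVneq i j.
  by subst j; rewrite res_embed_form h eq_Tagged.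
by rewrite res_embed_orth // -tag_eqE /tag_eq /= (negPf ij).
Qed.

Lemma glue_form0 X Y : (forall i u v, forms i (X i u) (Y i v) = 0) ->
  forall p q, form (glue X p) (glue Y q) = 0.
Proof.
by move=> h p q; rewrite (glue_form (c := 0)) ?if_same // => i u v; rewrite h if_same.
Qed.

Lemma glue_span X i u :
  u \in <<codom (X i)>>%VS -> iota i u \in <<codom (fun s : 'I_N => glue X (tagnat.sig s))>>%VS.
Proof.
case/span_codomP=> c ->; rewrite linear_sum; apply: memv_suml => j _.
rewrite linearZ /=; apply: memvZ; apply: memv_span.
apply/codomP; exists (@tagnat.Rank _ l i j).
by rewrite /tagnat.Rank tagnat.rankK.
Qed.

Lemma glue_sbasis : sbasis form E G.
Proof.
apply: (sbasis_span (rs_form_linear betaP (Q := Q)) (rs_form_skew betaP (Q := Q))).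
- apply/eqP; rewrite eqEsubv subvf; apply/subvP=> y _.
  have [w hw <-] := rs_pr_surj y; rewrite rs_pr_sum //; apply: memv_suml => i _.
  have [ex _ _ _] := nf_basis (nf i).
  rewrite (ex (rs_pr _ _)) linearD span_cat; apply: memv_add; apply: glue_span;
    by apply/span_codomP; eexists.
- move=> s t; rewrite (glue_form (c := 1)); first by rewrite (can_eq tagnat.sigK); case: eqP.
  by move=> i u v; have [_ -> _ _] := nf_basis (nf i); case: eqP.
- by move=> s t; apply: glue_form0 => i u v; have [_ _ -> _] := nf_basis (nf i).
- by move=> s t; apply: glue_form0 => i u v; have [_ _ _ ->] := nf_basis (nf i).
Qed.

Lemma glue_lagr : <<codom E>>%VS = rs_lagr Q.
Proof.
apply/eqP; rewrite eqEsubv; apply/andP; split.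
  apply/span_subvP=> v /codomP[s ->]; case: (tagnat.sig s) => i u.
  have := memv_span (codom_f (nf_E (nf i)) u); rewrite nf_lagr.
  case/rs_lagrE=> a Aa E; rewrite /glue /= -E res_embedE; last exact: ADs.
  by apply/rs_lagrE; exists (vsval a) => //; apply: sum_lattice_vsval.
apply/subvP=> y /rs_lagrE[a Aa <-]; rewrite rs_pr_sum; last exact: AD.
apply: memv_suml => i _; apply: glue_span; rewrite nf_lagr.
by apply/rs_lagrE; exists (comp i a).
Qed.

Lemma glue_mx t : reduction Q g (E t) = \sum_s C s t *: (if s \in S then G s else E s).
Proof.
rewrite -{2}[t]tagnat.sigK; case: (tagnat.sig t) => i m.
rewrite /glue /= reduction_res_embed nf_mx linear_sum big_rank.
(* The blocks have sizes depending on [i'] and [i]; [conform_mx] gives the diagonal ones the right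
   type and is the identity there. *)
have CE i' (j : 'I_(l i')) : C (@tagnat.Rank _ l i' j) (@tagnat.Rank _ l i m) =
    (if i' == i then conform_mx 0 (nf_C (nf i')) else 0 : 'M_(l i', l i)) j m.
  have /matrixP/(_ j m) := mxblockK (fun i1 i2 =>
    if i1 == i2 then conform_mx 0 (nf_C (nf i1)) else 0 : 'M_(l i1, l i2)) i' i.
  by rewrite mxE.
rewrite (bigD1 i) //= [X in _ + X]big1 ?addr0 => [|i' /negPf ii].
  apply: eq_bigr => j _; rewrite linearZ /= CE eqxx conform_mx_id; congr (_ *: _).
  by rewrite inE /tagnat.Rank tagnat.rankK /=; case: ifP.
by rewrite big1 // => j _; rewrite CE ii mxE scale0r.
Qed.

Lemma glue_card : #|S| = (\sum_i #|nf_S (nf i)|)%N.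
Proof.
rewrite -sum1_card big_mkcond big_rank; apply: eq_bigr => i _.
rewrite -sum1_card [RHS]big_mkcond; apply: eq_bigr => j _.
by rewrite inE /tagnat.Rank tagnat.rankK.
Qed.

End Glue.

Variables (theta : 'End(b) -> Fq) (thetas : forall i, 'End(rs_space (Qs i)) -> Fq).
Arguments thetas : clear implicits.
Hypothesis thetaP : theta_function theta.
Hypothesis thetasP : forall i, theta_function (thetas i).

(** [theta_normal_form] is applied to [theta] with the glued data and to each [thetas i] with its
    own; the block diagonal determinant and the cardinal of the glued set link the results. *)
Lemma theta_prod :
  [/\ forall i, thetas i (reduction (Qs i) (restr Ws i g)) != 0,
      eq_mod_squares (theta (reduction Q g))
        (\prod_i thetas i (reduction (Qs i) (restr Ws i g)))
    & rs_j (reduction Q g) =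
      (\sum_i rs_j (reduction (Qs i) (restr Ws i g)))%N].
Proof.
have nfs i : exists _ :
    normal_form (forms i) (rs_lagr (Qs i)) (reduction (Qs i) (restr Ws i g)), True.
  have [l [E [G [S [C [h1 h2 h3]]]]]] := reduction_normal_form (sbP i) (@BAs i)
    (@ADs i) (@gSs i) (gBs (i := i)) (gVBs (i := i)) (AsP i) (@dichs i g Tg)
    (thetasP i).
  by exists (NormalForm h1 h2 h3).
pose nf i := sval (cid (nfs i)).
have hS i := reduction_Sp (sbP i) (@gSs i) (gBs (i := i)) (gVBs (i := i)) (Q := Qs i).
have loc i := theta_normal_form (rs_form_linear (sbP i) (Q := Qs i))
  (rs_form_skew (sbP i) (Q := Qs i)) (thetasP i) (nf_basis (nf i))
  (nf_lagr (nf i)) (hS i) (nf_mx (nf i)).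
have [gl1 gl2] := theta_normal_form (rs_form_linear betaP (Q := Q))
  (rs_form_skew betaP (Q := Q)) thetaP (glue_sbasis nf) (glue_lagr nf)
  (reduction_Sp betaP gS gB gVB (Q := Q)) (glue_mx (nf := nf)).
split.
- by move=> i; have [h _ _ _] := thetasP i; apply/h/hS.
- apply: eq_mod_squares_trans gl1 _; rewrite det_mxdiag.
  apply: (big_ind2 (@eq_mod_squares Fq)) => [||i _].
  + exact: eq_mod_squares_refl.
  + by move=> *; apply: eq_mod_squaresM.
  + by apply: eq_mod_squares_sym; case: (loc i).
- by rewrite gl2 glue_card; apply: eq_bigr => i _; case: (loc i).
Qed.

End Lattices.

(** * Tensor products and slices *)

Definition transversal (k : fieldType) (W : vectType k) (M L : set W)
    (I : finType) (x : I -> W) : Prop :=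
  [/\ forall i, M (x i), forall a, M a -> exists i, L (x i - a)
    & forall i j, L (x i - x j) -> i = j].

Section FiniteTransversal.
Variables (k : fieldType) (Fq : finFieldType) (K : localField k Fq) (lam : int).
Variables (W : vectType k) (beta : W -> W -> k) (A B : set W).
Hypothesis betaP : symplectic_form beta.
Variable Q : residualSpace K lam beta A B.
Hypotheses (BA : B `<=` A) (AD : A `<=` dual_lattice K lam beta B).
Hypothesis AP : additive_subgroup A.
Variable g : 'End(W).
Hypothesis gS : Sp beta g.
Hypothesis gVB : forall w, B w -> B ((g^-1)%VF w).

(** [g] stabilizes B, so B is contained in the subgroup A n gA. The quotient is thus covered by A /
    B, which embeds in the finite space B^* / B. *)
Lemma exists_transversal :
  exists (I : finType) (x : I -> W), transversal A (A `&` g @` A) x.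
Proof.
have LP := capg_subgroup AP g; set L := A `&` g @` A in LP *.
have BL w : B w -> L w.
  move=> Bw; split; first exact: BA.
  exists ((g^-1)%VF w); first exact/BA/gVB.
  by rewrite lker0_lfunVK // (symp_Sp_inj betaP gS).
have fin : finite_set (reps A L).
  rewrite -(eq_finite_set (inj_card_eq (f := rs_pr Q) _)).
    by apply: sub_finite_set (@finite_vect _ (rs_space Q)).
  move=> r r'; rewrite !inE => hr hr' E; apply: (reps_eq LP hr hr'); apply: BL.
  by apply/(pr_eq betaP Q) => //; apply/AD/(mem_reps LP).
pose X := fset_set (reps A L).
have XE w : (w \in X) = (w \in reps A L) by apply: in_fset_set.
exists (fset_sub_type X : finType), (fun j => val j); split.
- by move=> j; have := valP j; rewrite XE inE => /(mem_reps LP).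
- move=> a Aa; have rX : rep A L a \in X by rewrite XE inE; apply: reps_rep.
  by exists [` rX]%fset => /=; case: (repP LP Aa).
- move=> i j h; apply: val_inj; apply: (reps_eq (M := A) LP) h.
    by have := valP i; rewrite XE inE.
  by have := valP j; rewrite XE inE.
Qed.

End FiniteTransversal.

Section WeilTensor.
Variables (R : realType) (k : fieldType) (Fq : finFieldType).
Variables (K : localField k Fq) (psi : k -> R[i]) (lam : int).
Hypothesis psiP : unitary_character K psi lam.
Variables (W : vectType k) (beta : W -> W -> k).
Hypothesis betaP : symplectic_form beta.
Variables (T : set 'End(W)) (n : nat) (Ws : 'I_n -> {vspace W}).
Hypotheses (TS : T `<=` Sp beta) (Tgroup : subgroup T).
Hypothesis WsP : torus_decomposition beta T Ws.
Local Notation comp := (component Ws).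
Local Notation sbeta := (sub_form beta Ws).
Variables (As Bs : forall i, set (subvs_of (Ws i))).
Arguments As : clear implicits.
Arguments Bs : clear implicits.
Local Notation A := (sum_lattice As).
Local Notation B := (sum_lattice Bs).
Local Notation dual := (dual_lattice K lam beta B).
Local Notation duals i := (dual_lattice K lam (sbeta i) (Bs i)).
Hypothesis AsP : forall i, additive_subgroup (As i).
Hypothesis BsP : forall i, additive_subgroup (Bs i).
Hypothesis BAs : forall i, Bs i `<=` As i.
Hypothesis ADs : forall i, As i `<=` duals i.
Hypothesis TBs : forall i g y, T g -> Bs i y -> Bs i (restr Ws i g y).
Hypothesis dichs : forall i g, T g ->
  (forall y, As i y -> As i (restr Ws i g y)) \/
  (forall y, As i y -> As i (restr Ws i g y) -> Bs i y).
Variables (Q : residualSpace K lam beta A B) (theta : 'End(rs_space Q) -> Fq).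
Variable Qs : forall i, residualSpace K lam (sbeta i) (As i) (Bs i).
Variable thetas : forall i, 'End(rs_space (Qs i)) -> Fq.
Arguments thetas : clear implicits.
Hypothesis thetaP : theta_function theta.
Hypothesis thetasP : forall i, theta_function (thetas i).
Let sbP i := sub_formP WsP i.
Let AP' : additive_subgroup A := AP AsP.
Let A_iso a a' : A a -> A a' -> videal (lf_val K) lam (beta a a').
Proof. exact: (lagr_isotropic betaP (AD betaP WsP BsP ADs) thetaP). Qed.
Let As_iso i a a' : As i a -> As i a' -> videal (lf_val K) lam (sbeta i a a').
Proof. exact: (lagr_isotropic (sbP i) (@ADs i) (thetasP i)). Qed.

Definition weil_factor (W' : vectType k) (beta' : W' -> W' -> k)
    (A' B' : set W') (Q' : residualSpace K lam beta' A' B')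
    (theta' : 'End(rs_space Q') -> Fq) (g : 'End(W')) : R[i] :=
  mfactor psi theta' (reduction Q' g) * sqrtC #|Fq|%:R ^+ rs_j (reduction Q' g).

Lemma weil_factor_prod g : T g ->
  weil_factor theta g = \prod_i weil_factor (thetas i) (restr Ws i g).
Proof.
move=> Tg; have [t0 tE jE] := theta_prod betaP TS Tgroup WsP AsP BsP BAs ADs TBs
  dichs Tg thetaP thetasP.
rewrite /weil_factor jE -prodrXr big_split /=; congr (_ * _).
exact: (mfactor_prod psiP t0 tE jE).
Qed.

(** The identity has normal form with [S] empty and [C = 1], leaving [(omega 1)^-1 * omega 1]. *)
Lemma weil_factor1 i : weil_factor (thetas i) \1%VF = 1.
Proof.
have bl := rs_form_linear (sbP i) (Q := Qs i).
have bC := rs_form_skew (sbP i) (Q := Qs i).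
have S1 : Sp (sbeta i) \1%VF by move=> x y; rewrite !id_lfunE.
have V1 y : Bs i y -> Bs i ((\1%VF)^-1%VF y).
  move=> By; have := lker0_lfunVK (symp_Sp_inj (sbP i) S1) y.
  by rewrite id_lfunE => ->.
have r1 : reduction (Qs i) \1%VF = \1%VF.
  apply/lfunP=> u; have [y hy <-] := rs_pr_surj u.
  rewrite (reductionE (sbP i) (Qs i) S1) ?id_lfunE // => w.
  by rewrite id_lfunE.
have [_ _ _ [e [f [/(symplectic_basisP bl bC)[ef ex] _]]]] := thetasP i.
have [|m|tE jE] := theta_normal_form (S := finset.set0) (C := 1%:M) (h := \1%VF)
  bl bC (thetasP i) ef ex.
- by move=> u v; rewrite !id_lfunE.
- rewrite id_lfunE; under eq_bigr do rewrite mxE inE.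
  by rewrite sum_deltaZ.
rewrite /weil_factor r1 /mfactor jE cards0 expr0 mulr1 subr0 expr1z.
rewrite (omega_mod_squares K psi lam tE) det1 mulVf //.
by apply: (omega_neq0 psiP); rewrite oner_neq0.
Qed.

Let transversals i g : T g -> exists (I : finType) (x : I -> subvs_of (Ws i)),
  transversal (As i) (As i `&` restr Ws i g @` As i) x.
Proof.
move=> Tg; apply: (exists_transversal (sbP i) (Qs i) (@BAs i) (@ADs i) (AsP i)
  (restr_Sp TS WsP (i := i) Tg)) => y.
exact: (TBVs betaP TS Tgroup WsP TBs).
Qed.

Lemma weil_op_tensor (phi : forall i, subvs_of (Ws i) -> R[i]) g w : T g ->
  (forall i a y, As i a ->
     phi i (a + y) = psi (2^-1 * sbeta i y a) * phi i y) ->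
  (forall a w, A a -> tensor phi (a + w) = psi (2^-1 * beta w a) * tensor phi w) ->
  weil_op psi theta g (tensor phi) w =
  \prod_i weil_op psi (thetas i) (restr Ws i g) (phi i) (comp i w).
Proof.
move=> Tg phiA tphiA.
pose I_ i : finType := sval (cid (transversals i Tg)).
pose x_ i : I_ i -> subvs_of (Ws i) := sval (cid (svalP (cid (transversals i Tg)))).
have xT i : transversal (As i) (As i `&` restr Ws i g @` As i) (@x_ i).
  exact: svalP (cid (svalP (cid (transversals i Tg)))).
pose x (t : fprod I_) := \sum_i vsval (x_ i (t i)).
have cx t i : comp i (x t) = x_ i (t i) by apply: (comp_sum WsP (fun i => x_ i (t i))).
have capP := capg_sumP betaP TS WsP As _ Tg.
rewrite (weil_op_transversal psiP betaP theta AP' A_iso (TS Tg) tphiA (x := x)).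
- rewrite card_fprod natr_prod -prodfV -/(weil_factor theta g) weil_factor_prod //.
  have -> : \sum_t psi (2^-1 * beta (x t) w) * tensor phi ((g^-1)%VF (x t + w)) =
      \sum_(t : fprod I_) \prod_i (psi (2^-1 * sbeta i (x_ i (t i)) (comp i w))
        * phi i ((restr Ws i g)^-1%VF (x_ i (t i) + comp i w))).
    apply: eq_bigr => t _; rewrite big_split /= (beta_sum betaP WsP) mulr_sumr.
    rewrite (psi_sum psiP); congr (_ * _); apply: eq_bigr => i _; rewrite ?cx //.
    by rewrite (comp_TV betaP TS WsP) // linearD /= cx.
  rewrite -(prod_sum_fprod (fun i j => psi (2^-1 * sbeta i (x_ i j) (comp i w))
    * phi i ((restr Ws i g)^-1%VF (x_ i j + comp i w)))) -!big_split /=.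
  apply: eq_bigr => i _; have [xA xc xi] := xT i.
  rewrite (weil_op_transversal psiP (sbP i) (thetas i) (AsP i) (@As_iso i)
    (restr_Sp TS WsP Tg) (@phiA i) _ xA xc xi) //.
- by move=> t i; rewrite cx; case: (xT i).
- move=> a Aa.
  have h i : exists j, (As i `&` restr Ws i g @` As i) (x_ i j - comp i a).
    by have [_ + _] := xT i; apply.
  exists (fprod_of_fun (fun i => sval (cid (h i)))); apply/capP=> i.
  by rewrite linearB /= cx fprodE; exact: svalP (cid (h i)).
- move=> t t' /capP h; apply/fprodP=> i; have [_ _ xi] := xT i; apply: xi.
  by have := h i; rewrite linearB /= !cx.
Qed.

(** The translation [c] has no component in W_i, so it is orthogonal to A_i and adds no phase. *)
Lemma slice_quasiperiodic (phi : W -> R[i]) i c :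
  (forall a w, A a -> phi (a + w) = psi (2^-1 * beta w a) * phi w) ->
  comp i c = 0 -> forall a z, As i a ->
  phi (vsval (a + z) + c) = psi (2^-1 * sbeta i z a) * phi (vsval z + c).
Proof.
move=> phiA c0 a z Aa.
rewrite linearD /= -addrA (phiA _ _ (sum_lattice_vsval WsP AsP Aa)).
rewrite (symp_skew betaP) (beta_vsval betaP WsP) -(symp_skew (sbP i)).
by rewrite linearD /= c0 addr0 (comp_vsval WsP).
Qed.

(** The embedded element [h] is the identity outside W_i, so A n hA differs from A only in the
    component [i]: a transversal for W_i is also one for W, and the other scalars are
    [weil_factor1]. *)
Lemma weil_op_embed (phi : W -> R[i]) i g c y : T g ->
  (forall a w, A a -> phi (a + w) = psi (2^-1 * beta w a) * phi w) ->
  comp i c = 0 ->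
  weil_op psi theta (embed Ws i (restr Ws i g)) phi (vsval y + c) =
  weil_op psi (thetas i) (restr Ws i g) (fun z => phi (vsval z + c)) y.
Proof.
move=> Tg phiA c0; have [Te ei ej] := embed_restr Tgroup WsP i Tg.
set h := embed _ _ _ in Te ei ej *.
have phiA' := slice_quasiperiodic phiA c0.
have [I [x [xA xc xi]]] := transversals i Tg.
have inv1 (V : vectType k) (z : V) : (\1^-1)%VF z = z.
  rewrite -{1}(id_lfunE z) lker0_lfunK //.
  by apply/lker0P=> u v; rewrite !id_lfunE.
have capP := capg_sumP betaP TS WsP As _ Te.
have cap1 j a : j != i -> As j a -> (As j `&` restr Ws j h @` As j) a.
  by move=> ji Aa; split=> //; exists a; rewrite // ej // id_lfunE.
rewrite (weil_op_transversal psiP (sbP i) (thetas i) (AsP i) (@As_iso i)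
  (restr_Sp TS WsP Tg) phiA' _ xA xc xi).
rewrite (weil_op_transversal psiP betaP theta AP' A_iso (TS Te) phiA
  (x := fun j => vsval (x j))).
- congr (_ * _); last first.
    apply: eq_bigr => j _; congr (psi (_ * _) * phi _).
      by rewrite (beta_vsval betaP WsP) linearD /= c0 addr0 (comp_vsval WsP).
    apply: (comp_inj WsP) => m; rewrite (comp_TV betaP TS WsP) // !linearD /=.
    have [E|mi] := eqVneq m i.
      by subst m; rewrite c0 linear0 !addr0 !(comp_vsval WsP) ei.
    by rewrite !(comp_vsval_neq WsP) // linear0 !add0r ej // inv1.
  congr (_ / _); rewrite -/(weil_factor theta h) weil_factor_prod // (bigD1 i) //=.
  rewrite ei big1 ?mulr1 // => j ji; by rewrite ej // weil_factor1.
- by move=> j; apply: (sum_lattice_vsval WsP AsP).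
- move=> a Aa; have [j hj] := xc _ (Aa i); exists j; apply/capP=> m.
  rewrite linearB /=; have [E|mi] := eqVneq m i.
    by subst m; rewrite (comp_vsval WsP) ei.
  rewrite (comp_vsval_neq WsP) // sub0r; apply: cap1 => //.
  by apply: asgN; [exact: AsP | exact: Aa].
- move=> j j' /capP/(_ i); rewrite -linearB (comp_vsval WsP) ei; exact: xi.
Qed.

Lemma tensor_quasiperiodic (phi : forall i, subvs_of (Ws i) -> R[i]) :
  (forall i a y, As i a ->
     phi i (a + y) = psi (2^-1 * sbeta i y a) * phi i y) ->
  forall a w, A a -> tensor phi (a + w) = psi (2^-1 * beta w a) * tensor phi w.
Proof.
move=> phiA a w Aa; rewrite (beta_sum betaP WsP) mulr_sumr (psi_sum psiP).
rewrite -big_split; apply: eq_bigr => i _ /=.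
by rewrite linearD phiA //; exact: Aa.
Qed.

(** A finite set of representatives modulo A maps injectively, by taking representatives of the
    components modulo the A_i, into a product of finite sets [Z i]. Expanding the product over these
    bounds every partial sum by the product of the squared norms. *)
Lemma sqnorm_tensor (phi : forall i, subvs_of (Ws i) -> R[i]) :
  (forall i, hilbert psi (sbeta i) (As i) (phi i)) ->
  (sqnorm A (tensor phi) < +oo)%E.
Proof.
move=> phiH; pose s i := fine (sqnorm (As i) (phi i)).
have sE i : sqnorm (As i) (phi i) = (s i)%:E.
  rewrite fineK // ge0_fin_numE; first by case: (phiH i).
  by apply: esum_ge0 => w _; rewrite lee_fin; exact: sqmod_ge0.
apply: (@le_lt_trans _ _ (\prod_i s i)%:E); last exact: ltry.
apply: ge_ereal_sup => _ [X [finX XS] <-].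
rewrite fsbig_finite //= sumEFin lee_fin; set Y := fset_set X.
pose r i (w : W) := rep setT (As i) (comp i w).
have rP i w : As i (r i w - comp i w) by case: (repP (M := setT) (AsP i) (a := comp i w)).
pose Z i := [fset r i w | w in Y]%fset.
have rZ i (w : Y) : r i (val w) \in Z i by apply: in_imfset; exact: valP.
pose F i (z : Z i) := sqmod (phi i (val z)).
pose f (w : Y) : fprod (fun i => (Z i : finType)) :=
  fprod_of_fun (fun i => [` rZ i w]%fset).
have f_inj : injective f.
  move=> w w' E; apply: val_inj; have YS (v : Y) : reps setT A (val v).
    by apply: XS; have := valP v; rewrite in_fset_set // inE.
  apply: (reps_eq AP' (YS w) (YS w')) => i; rewrite linearB /=.
  have := congr1 (fun t : fprod _ => val (t i)) E; rewrite !fprodE /= => Er.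
  rewrite -(subrKA (r i (val w))); apply: (asgD (AsP i)).
    by rewrite -opprB; apply: (asgN (AsP i)); apply: rP.
  by rewrite Er; apply: rP.
have tE (w : Y) : sqmod (tensor phi (val w)) = \prod_i F i (f w i).
  rewrite sqmod_prod; apply: eq_bigr => i _; rewrite /F fprodE /=.
  apply/esym/(sqmod_periodic psiP (beta := sbeta i) (A := As i)) => //.
  by case: (phiH i).
rewrite (big_seq_fsetE _ Y xpredT (fun w => sqmod (tensor phi w))) /=.
under eq_bigr do rewrite tE.
have F0 i z : 0 <= F i z by exact: sqmod_ge0.
apply: (@le_trans _ _ (\sum_(t : fprod (fun i => (Z i : finType))) \prod_i F i (t i))).
  rewrite -(big_imset (fun t : fprod _ => \prod_i F i (t i)) (h := f) (A := predT)) /=.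
    by rewrite big_mkcond; apply: ler_sum => t _; case: ifP => // _; apply: prodr_ge0.
  by move=> w w' _ _; apply: f_inj.
rewrite -(prod_sum_fprod F); apply: ler_prod => i _; apply/andP; split.
  by apply: sumr_ge0.
rewrite -lee_fin -sE; apply: ereal_sup_ubound; exists [set` Z i].
  split=> [|z /= /imfsetP[w _ ->]]; first exact: finite_fset.
  exact: reps_rep.
rewrite (fsbig_finite _ _ (finite_fset (Z i))) set_fsetK sumEFin; congr EFin.
by rewrite (big_seq_fsetE _ (Z i) xpredT (fun z => sqmod (phi i z))).
Qed.

Variables (v : k -> int) (chi : 'End(W) -> R[i]).
Hypothesis chiP : character v T chi.

Lemma eigenfunction_tensor (phi : forall i, subvs_of (Ws i) -> R[i]) :
  (forall i, eigenfunction psi (thetas i) (sub_torus T Ws i)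
               (fun t => chi (embed Ws i t)) (phi i)) ->
  eigenfunction psi theta T chi (tensor phi).
Proof.
move=> phiE; have phiH i : hilbert psi (sbeta i) (As i) (phi i).
  by case: (phiE i).
have phiA i a y : As i a ->
    phi i (a + y) = psi (2^-1 * sbeta i y a) * phi i y.
  by case: (phiH i) => + _; apply.
have tphiA := tensor_quasiperiodic phiA.
split; first by split; [exact: tphiA | exact: sqnorm_tensor].
- have w_ i : exists y, phi i y != 0.
    have [_ phi0 _] := phiE i; apply/not_existsP => h; apply: phi0.
    by apply/funext => y; have /negP/negPn/eqP := h y.
  pose w := \sum_i vsval (sval (cid (w_ i))).
  move/(congr1 (fun f => f w)); apply/eqP; apply/prodf_neq0 => i _.
  rewrite (comp_sum WsP (fun i => sval (cid (w_ i)))).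
  exact: svalP (cid (w_ i)).
- move=> g Tg; apply/funext => w.
  rewrite /weil /= (weil_op_tensor w Tg phiA tphiA).
  rewrite (character_prod Tgroup WsP chiP Tg) -big_split.
  apply: eq_bigr => i _; have [_ _ h] := phiE i.
  have Ti : sub_torus T Ws i (restr Ws i g) by exists g.
  exact: (congr1 (fun f => f (comp i w)) (h _ Ti)).
Qed.

Lemma eigenfunction_slice (phi : W -> R[i]) i w0 :
  eigenfunction psi theta T chi phi -> phi w0 != 0 ->
  eigenfunction psi (thetas i) (sub_torus T Ws i)
    (fun t => chi (embed Ws i t))
    (fun z => phi (vsval z + (w0 - vsval (comp i w0)))).
Proof.
(* [c] is the part of [w0] outside W_i: it has component 0 at [i], and the slice takes the nonzero
   value [phi w0] at [comp i w0]. *)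
move=> [[phiA phi_fin] _ phiT] w00; set c := w0 - _.
have c0 : comp i c = 0 by rewrite linearB /= (comp_vsval WsP) subrr.
split; first split.
- exact: slice_quasiperiodic.
- apply: le_lt_trans phi_fin.
  apply: (sqnorm_comp psiP (beta' := beta) (f := fun z => vsval z + c)
    (AsP i) AP' _ phiA) => x y.
  rewrite opprD addrACA subrr addr0 -linearB => /(_ i).
  by rewrite (comp_vsval WsP).
- move/(congr1 (fun f => f (comp i w0))) => /eqP.
  by rewrite addrC subrK (negPf w00).
- move=> _ [g Tg <-]; apply/funext => z.
  rewrite /weil /= -(weil_op_embed z Tg phiA c0).
  have [Te _ _] := embed_restr Tgroup WsP i Tg.
  exact: (congr1 (fun f => f (vsval z + c)) (phiT _ Te)).
Qed.

End WeilTensor.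

Theorem mainTheorem16 (R : realType) (k : fieldType) (Fq : finFieldType)
  (K : localField k Fq) (psi : k -> R[i]) (lam : int)
  (psiP : unitary_character K psi lam)
  (W : vectType k) (beta : W -> W -> k) (betaP : symplectic_form beta)
  (W_neq0 : (0 < \dim {:W})%N)
  (T : set 'End(W)) (TP : maximal_elliptic_torus beta T)
  (n : nat) (Ws : 'I_n -> {vspace W}) (WsP : torus_decomposition beta T Ws)
  (D : forall i : 'I_n, irreducibleTorus K (sub_form beta Ws i) (sub_torus T Ws i))
  (Bs := fun i : 'I_n => it_B lam (D i))
  (As := fun i : 'I_n => it_A lam (D i))
  (B := sum_lattice Bs) (A := sum_lattice As)
  (Q : residualSpace K lam beta A B)
  (theta : 'End(rs_space Q) -> Fq) (thetaP : theta_function theta)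
  (Qs : forall i : 'I_n,
     residualSpace K lam (sub_form beta Ws i) (As i) (Bs i))
  (thetas : forall i : 'I_n, 'End(rs_space (Qs i)) -> Fq)
  (thetasP : forall i : 'I_n, theta_function (thetas i)) :
  forall chi : 'End(W) -> R[i], character (lf_val K) T chi ->
  (occurs psi theta T chi <->
     forall i : 'I_n,
       occurs psi (thetas i) (sub_torus T Ws i) (fun t => chi (embed Ws i t)))
  /\
  (occurs psi theta T chi ->
     forall phi : forall i : 'I_n, subvs_of (Ws i) -> R[i],
       (forall i : 'I_n, eigenfunction psi (thetas i) (sub_torus T Ws i)
                           (fun t => chi (embed Ws i t)) (phi i)) ->
       eigenfunction psi theta T chi (tensor phi)).
Proof.
have [[[TS Tgroup _ _ _] _] _] := TP.
have AsP i : additive_subgroup (As i) := it_A_subgroup lam (D i).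
have BsP i : additive_subgroup (Bs i) := it_B_subgroup lam (D i).
have BAs i : Bs i `<=` As i by apply: it_B_sub_A.
have ADs i : As i `<=` dual_lattice K lam (sub_form beta Ws i) (Bs i).
  exact: it_A_sub_dual.
have Ti i g : T g -> sub_torus T Ws i (restr Ws i g) by exists g.
have TBs i g y : T g -> Bs i y -> Bs i (restr Ws i g y).
  by move=> /(Ti i); apply: torus_stable_B.
have dichs i g : T g -> (forall y, As i y -> As i (restr Ws i g y)) \/
    (forall y, As i y -> As i (restr Ws i g y) -> Bs i y).
  by move=> /(Ti i); apply: torus_dichotomy.
move=> chi chiP.
have tensorE := @eigenfunction_tensor _ _ _ _ _ _ psiP _ _ betaP _ _ _ TS Tgroup
  WsP _ _ AsP BsP BAs ADs TBs dichs _ _ _ _ thetaP thetasP _ _ chiP.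
split; last by move=> _; exact: tensorE.
split=> [[phi phiE] i|occ].
  have [w0 w00] : exists w0, phi w0 != 0.
    have [_ phi0 _] := phiE; apply/not_existsP => h; apply: phi0.
    by apply/funext => w; have /negP/negPn/eqP := h w.
  eexists; exact: (@eigenfunction_slice _ _ _ _ _ _ psiP _ _ betaP _ _ _ TS Tgroup
    WsP _ _ AsP BsP BAs ADs TBs dichs _ _ _ _ thetaP thetasP chi phi i w0 phiE w00).
exists (tensor (fun i => sval (cid (occ i)))); apply: tensorE => i.
exact: svalP (cid (occ i)).
Qed.
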